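(* Let $q$ be an odd prime power. Let $\mathcal{V}_4$ be any set of the form $\mathcal{S}_j\cup\mathcal{E}_k$, or $\mathcal{H}_1\cup\mathcal{E}_k$, or $\mathcal{S}_j\cup\mathcal{H}_2$, with $j \in \{1, \dots, q\} \setminus \{(q+1)/2\}$ and $k \in \{1, \dots, q-2\} \setminus \{(q-1)/2\}$. Then $\mathcal{V}_4$ is not projectively equivalent (under $\mathrm{PGL}(4,q^2)$) to any quasi-Hermitian surface of type $\mathcal{V}_1$, $\mathcal{V}_2$ or $\mathcal{V}_3$.
   Context: $q$ is an odd prime power and $\xi$ is a fixed primitive element of $\mathbb{F}_{q^2}$. $\mathrm{PG}(3,q^2)$ has homogeneous coordinates $(X_1,X_2,X_3,X_4)$. $\mathcal{H}(3,q^2)$ is the Hermitian surface $X_1^qX_4+X_1X_4^q-X_2^{q+1}-X_3^{q+1}=0$, and $\mathcal{O}=\{(1,t,t^q,t^{q+1}) : t\in\mathbb{F}_{q^2}\}\cup\{(0,0,0,1)\}$. For $\gamma\in\mathbb{F}_{q^2}$ let $F_\gamma=X_1^q X_4 + X_1 X_4^q - X_2^{q+1} - X_3^{q+1} - \gamma (X_1 X_4 - X_2 X_3)^{\frac{q+1}{2}}$. For $j\in\{1,\dots,q\}\setminus\{(q+1)/2\}$, $\mathcal{S}_j$ is the set of points with $F_\gamma=0$, $\gamma=\xi^{j\frac{q-1}{2}}+\xi^{-j\frac{q-1}{2}}$; for $k\in\{0,\dots,q-1\}\setminus\{(q-1)/2\}$, $\mathcal{E}_k$ is the set of points with $F_\gamma=0$,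 $\gamma=\xi^{k\frac{q+1}{2}}+\xi^{-k\frac{q+1}{2}}$. $K$ is the group of projectivities induced (on column vectors) by the Kronecker products $A^q\otimes A$, $A\in \mathrm{SL}(2,q^2)$ ($A^q$: all entries raised to the $q$-th power). $K$ has exactly two orbits on the points of $\mathcal{H}(3,q^2)\setminus\mathcal{O}$; $\mathcal{H}_1$ is the one of size $q^2(q^2+1)(q-1)/2$ and $\mathcal{H}_2$ the one of size $q^2(q^2+1)(q+1)/2$. Type $\mathcal{V}_1$: let $\pi$ be a plane tangent to a non-degenerate Hermitian surface $\mathcal{H}(3,q^2)$ at a point $P$, let $g_1,\dots,g_{q+1}$ be the $q+1$ lines of $\mathcal{H}(3,q^2)$ through $P$, and let $\ell_1,\dots,\ell_{q+1}$ be $q+1$ (distinct) lines of $\pi$ through $P$; then $\mathcal{V}_1=\bigcup_i \ell_i\cup\left(\mathcal{H}(3,q^2)\setminus\bigcup_i g_i\right)$. Type $\mathcal{V}_2$: fix $\alpha\in\mathbb{F}_{q^2}\setminus\{0\}$, $\beta\in\mathbb{F}_{q^2}\setminus\mathbb{F}_q$ with $4\alpha^{q+1}+(\beta^q-\beta)^2\neq 0$; then $\mathcal{V}_2=\{(1,x,y,z): x,y,z\in\mathbb{F}_{q^2},\ G(x,y,z)=0\}\cup\{(0,x,y,z): x,y,z\in\mathbb{F}_{q^2},\ (x,y,z)\neq(0,0,0),\ x^{q+1}+y^{q+1}=0\}$, where $G(x,y,z)=z^q-z+\alpha^q(x^{2q}+y^{2q})-\alpha(x^2+y^2)-(\beta^q-\beta)(x^{q+1}+y^{q+1})$.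 Type $\mathcal{V}_3$: let $\Sigma'$ be a Baer subgeometry of $\mathrm{PG}(3,q^2)$ and let $\mathcal{L}$ be a set of lines of $\mathrm{PG}(3,q^2)$, each having $q+1$ points in common with $\Sigma'$, such that through each point of $\Sigma'$ there pass exactly $q+1$ lines of $\mathcal{L}$; then $\mathcal{V}_3=\bigcup_{\ell\in\mathcal{L}}\ell$. (This includes the case in which $\mathcal{L}$ consists of the lines meeting $\Sigma'$ in $q+1$ points and meeting a fixed non-degenerate quadric of $\Sigma'$ in either $1$ or $q+1$ points.) *)

(* Defs.v *)
From HB Require Import structures.
From mathcomp Require Import all_boot all_order all_fingroup all_algebra.
From mathcomp Require Import mxtens.

Set Implicit Arguments.
Unset Strict Implicit.
Unset Printing Implicit Defensive.

Import GRing.Theory.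
Local Open Scope ring_scope.

(* Subspaces over a finite field form a finite type, so that sets of points,
   lines and planes can be handled as {set {vspace _}}. *)
Section FiniteSubspaces.
Import VectorInternalTheory.
Variables (K : finFieldType) (vT : vectType K).
HB.instance Definition _ := [Finite of {vspace vT} by <:].
End FiniteSubspaces.

Section ProjectiveSpace.

(* Throughout, F plays the role of F_(q^2); the hypothesis #|F| = q ^ 2 is only
   made in the theorem. The points, lines and planes of PG(3, F) are the
   subspaces of F^4 (column vectors) of dimension 1, 2 and 3. *)
Variables (F : finFieldType) (q : nat).

Local Notation space := {vspace 'cV[F]_4}.

Definition PG3 : {set space} := [set P : space | (\dim P == 1)%N].

Definition vec4 (a b c d : F) : 'cV[F]_4 := \col_(i < 4) [:: a; b; c; d]`_i.
Arguments vec4 (a b c d)%_R.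

(* the homogeneous coordinate X_(i+1) *)
Definition coord (v : 'cV[F]_4) (i : nat) : F := v (inord i) 0.

Definition points_of (U : space) : {set space} :=
  [set P in PG3 | (P <= U)%VS].

(* The points at which f vanishes; every f used below satisfies
   f (a *: v) = a ^+ (q + 1) * f v. *)
Definition zeros (f : 'cV[F]_4 -> F) : {set space} :=
  [set P in PG3 | [forall v : 'cV[F]_4, (v \in P) ==> (f v == 0)]].

Definition proj_map (M : 'M[F]_4) (P : space) : space :=
  (linfun (mulmx M : 'cV[F]_4 -> 'cV[F]_4) @: P)%VS.

Definition proj_equiv (X Y : {set space}) : Prop :=
  exists2 M : 'M[F]_4, M \in unitmx & Y = proj_map M @: X.

Definition frob_mx m n (A : 'M[F]_(m, n)) : 'M[F]_(m, n) :=
  map_mx (fun x => x ^+ q) A.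

Definition herm_eq (v : 'cV[F]_4) : F :=
  let X := coord v in
  X 0%N ^+ q * X 3%N + X 0%N * X 3%N ^+ q - X 1%N ^+ q.+1 - X 2%N ^+ q.+1.

Definition HS : {set space} := zeros herm_eq.

Definition OO : {set space} :=
  [set <[vec4 1 t (t ^+ q) (t ^+ q.+1)]>%VS | t : F]
    :|: [set <[vec4 0 0 0 1]>%VS].

Definition F_eq (gamma : F) (v : 'cV[F]_4) : F :=
  let X := coord v in
  herm_eq v - gamma * (X 0%N * X 3%N - X 1%N * X 2%N) ^+ (q.+1 %/ 2).

Definition S_set (xi : F) (j : nat) : {set space} :=
  zeros (F_eq (xi ^+ (j * (q.-1 %/ 2)) + xi ^- (j * (q.-1 %/ 2)))).

Definition E_set (xi : F) (k : nat) : {set space} :=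
  zeros (F_eq (xi ^+ (k * (q.+1 %/ 2)) + xi ^- (k * (q.+1 %/ 2)))).

(* The type 'M_(2 * 2) of a Kronecker product is convertible to 'M_4. *)
Definition kron (A : 'M[F]_2) : 'M[F]_4 := frob_mx A *t A.

Definition K_orbit (P : space) : {set space} :=
  [set proj_map (kron A) P | A : 'M[F]_2 & \det A == 1].

Definition K_orbits : {set {set space}} :=
  [set K_orbit P | P in HS :\: OO].

Definition is_H1 (X : {set space}) : Prop :=
  X \in K_orbits /\ #|X| = (q ^ 2 * (q ^ 2 + 1) * (q - 1) %/ 2)%N.

Definition is_H2 (X : {set space}) : Prop :=
  X \in K_orbits /\ #|X| = (q ^ 2 * (q ^ 2 + 1) * (q + 1) %/ 2)%N.

Definition j_range (j : nat) : bool :=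
  (1 <= j <= q)%N && (j != q.+1 %/ 2)%N.

Definition k_range (k : nat) : bool :=
  (1 <= k <= q - 2)%N && (k != q.-1 %/ 2)%N.

Definition type_V4 (xi : F) (V : {set space}) : Prop :=
  [\/ exists j k, [/\ j_range j, k_range k & V = S_set xi j :|: E_set xi k],
      exists H1 k, [/\ is_H1 H1, k_range k & V = H1 :|: E_set xi k]
    | exists j H2, [/\ j_range j, is_H2 H2 & V = S_set xi j :|: H2]].

(* The sesquilinear form attached to A, linear in its second argument. *)
Definition sesqui (A : 'M[F]_4) (u v : 'cV[F]_4) : F :=
  ((frob_mx u)^T *m A *m v) 0 0.

Definition nondeg_hermitian (A : 'M[F]_4) : bool :=
  (A \in unitmx) && ((frob_mx A)^T == A).

Definition herm_surface (A : 'M[F]_4) : {set space} :=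
  zeros (fun v => sesqui A v v).

(* By dimension, pi is then the whole polar plane of P. *)
Definition tangent_plane (A : 'M[F]_4) (P pi : space) : Prop :=
  [/\ P \in herm_surface A, (\dim pi = 3)%N
    & forall u v : 'cV[F]_4, u \in P -> v \in pi -> sesqui A u v = 0].

Definition gens_through (A : 'M[F]_4) (P : space) : {set space} :=
  [set g : space | [&& (\dim g == 2)%N, (P <= g)%VS
                     & points_of g \subset herm_surface A]].

Definition type_V1 (V : {set space}) : Prop :=
  exists (A : 'M[F]_4) (P pi : space) (L : {set space}),
    [/\ nondeg_hermitian A, tangent_plane A P pi,
        #|L| = q.+1,
        forall l, l \in L -> [/\ (\dim l = 2)%N, (P <= l)%VS & (l <= pi)%VS]
      & V = (\bigcup_(l in L) points_of l)
              :|: (herm_surface A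
                     :\: \bigcup_(g in gens_through A P) points_of g)].

Definition G_eq (alpha beta x y z : F) : F :=
  z ^+ q - z + alpha ^+ q * (x ^+ (2 * q) + y ^+ (2 * q))
    - alpha * (x ^+ 2 + y ^+ 2)
    - (beta ^+ q - beta) * (x ^+ q.+1 + y ^+ q.+1).

Definition type_V2 (V : {set space}) : Prop :=
  exists alpha beta : F,
    [/\ alpha != 0, beta ^+ q != beta,
        4%:R * alpha ^+ q.+1 + (beta ^+ q - beta) ^+ 2 != 0
      & V = [set <[vec4 1 w.1.1 w.1.2 w.2]>%VS
               | w : F * F * F & G_eq alpha beta w.1.1 w.1.2 w.2 == 0]
              :|: [set <[vec4 0 w.1.1 w.1.2 w.2]>%VS
                     | w : F * F * F
                     & (w != (0, 0, 0))
                       && (w.1.1 ^+ q.+1 + w.1.2 ^+ q.+1 == 0)]].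

(* The canonical Baer subgeometry PG(3, q): the points having a representative
   with all coordinates in F_q = {x | x ^+ q = x}. *)
Definition canonical_baer : {set space} :=
  [set <[v]>%VS | v : 'cV[F]_4 & (v != 0) && (frob_mx v == v)].

Definition baer_subgeometry (S : {set space}) : Prop :=
  proj_equiv canonical_baer S.

Definition type_V3 (V : {set space}) : Prop :=
  exists S L : {set space},
    [/\ baer_subgeometry S,
        forall l, l \in L -> (\dim l = 2)%N /\ #|points_of l :&: S| = q.+1,
        forall P, P \in S -> #|[set l in L | (P <= l)%VS]| = q.+1
      & V = \bigcup_(l in L) points_of l].

End ProjectiveSpace.

(* Main.v *)
(* Every set V of type V4 contains the elliptic quadric O (the set [OO]), and the pair (V, O)
   has four projectively invariant properties: O lies in no plane; every point of O is on at
   least three lines of V; every point of V off O is on at most two lines of V; a line of V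
   has at most one point in O. Sets of type V1, V2, V3 admit no such O:
   - V3: the points of the Baer subgeometry are on q + 1 lines, hence all lie in O, but each
     line of L has q + 1 of them;
   - V2: an affine point is on at most two lines (compare coefficients of [G_eq] along a
     line), so O would lie in the plane at infinity;
   - V1: a line of V through a point x of O off the tangent plane at p meets that plane in a
     point y of a generator g = <p, y> that belongs to L; then g, <x, y> and a further
     generator <y, x + b p> lie in V, so y is in O, together with x.

   Identify a vector with a 2x2 matrix, let Q ([quad]) be its determinant, N = Q^((q+1)/2), and
   H the Hermitian form. On a line of V, (H - g1 N)(H - g2 N) vanishes; it has degree 2q + 2 < q^2,
   so one factor vanishes, and N^q is a constant multiple of N on the line. This forces Q to
   have a double zero there: the line meets O in a point polar to all its points. For the
   lines at points of O, the group K reduces to (1, 0, 0, 0); H_2 is recognized among the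
   K-orbits by its size, the others having representatives (s, 0, 0, t) with too large a
   stabilizer. *)

Require Import Defs.
From mathcomp Require Import all_boot all_order all_fingroup all_algebra.
From mathcomp Require Import finfield mxtens ring zify.

Set Implicit Arguments.
Unset Strict Implicit.
Unset Printing Implicit Defensive.

Import GRing.Theory.

(** * Points, lines and projectivities *)

Section Projectivities.
Local Open Scope ring_scope.
Variable F : finFieldType.
Local Notation space := {vspace 'cV[F]_4}.
Implicit Types (P Q l pi : space) (V O : {set space}) (v w r : 'cV[F]_4).

Definition line_in V l : bool := (\dim l == 2)%N && (points_of l \subset V).

(* For a set V of type V4, O is [OO]. *)
Record configuration V O : Prop := Configuration {
  conf_span : forall u : 'rV[F]_4, u != 0 ->
    exists v, [/\ v != 0, <[v]>%VS \in O & u *m v != 0];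
  conf_many : forall P, P \in O -> exists ls : seq space,
    [/\ uniq ls, size ls = 3%N & all (fun l => line_in V l && (P <= l)%VS) ls];
  conf_few : forall P (ls : seq space), P \in V -> P \notin O ->
    uniq ls -> all (fun l => line_in V l && (P <= l)%VS) ls -> (size ls <= 2)%N;
  conf_cap : forall l P Q, line_in V l -> P \in O -> Q \in O ->
    (P <= l)%VS -> (Q <= l)%VS -> P = Q }.

Lemma proj_mapK (M N : 'M[F]_4) : M *m N = 1%:M -> cancel (proj_map N) (proj_map M).
Proof.
move=> MN P; rewrite /proj_map -limg_comp.
suff -> : (linfun (mulmx M : 'cV_4 -> 'cV_4) \o linfun (mulmx N : 'cV_4 -> 'cV_4))%VF = \1%VF
  by rewrite lim1g.
by apply/lfunP=> v; rewrite comp_lfunE !lfunE /= mulmxA MN mul1mx.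
Qed.

Lemma dim_proj_map (M : 'M[F]_4) P : M \in unitmx -> \dim (proj_map M P) = \dim P.
Proof.
move=> uM; apply: limg_dim_eq; suff -> : lker (linfun (mulmx M : 'cV_4 -> 'cV_4)) = 0%VS by rewrite capv0.
apply/eqP/lker0P=> u v; rewrite !lfunE /= => /(congr1 (mulmx (invmx M))).
by rewrite !mulKmx.
Qed.

Lemma proj_mapS (M : 'M[F]_4) P Q : (P <= Q)%VS -> (proj_map M P <= proj_map M Q)%VS.
Proof. exact: limgS. Qed.

Lemma line_in_proj_map (M : 'M[F]_4) V l : M \in unitmx -> line_in V l ->
  line_in (proj_map M @: V) (proj_map M l).
Proof.
move=> uM /andP[dl /subsetP lV]; rewrite /line_in dim_proj_map // dl /=.
have MN := mulmxV uM; have NM := mulVmx uM.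
apply/subsetP=> P; rewrite !inE => /andP[dP Pl].
apply/imsetP; exists (proj_map (invmx M) P); last by rewrite (proj_mapK MN).
apply: lV; rewrite !inE dim_proj_map ?unitmx_inv // dP /=.
by rewrite -[l](proj_mapK NM) proj_mapS.
Qed.

(** The four properties only involve incidence, which [proj_map M] and its inverse preserve; a plane
    [u] is pulled back to [u *m M]. *)
Lemma configuration_proj_map (M : 'M[F]_4) V O : M \in unitmx -> configuration V O ->
  configuration (proj_map M @: V) (proj_map M @: O).
Proof.
move=> uM [span many few cap].
have uN : invmx M \in unitmx by rewrite unitmx_inv.
have fK := proj_mapK (mulVmx uM); have gK := proj_mapK (mulmxV uM).
have backI (X : {set space}) : proj_map (invmx M) @: (proj_map M @: X) = X.
  by rewrite -imset_comp (eq_imset _ fK) imset_id.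
have memI (X : {set space}) P : (proj_map M P \in proj_map M @: X) = (P \in X).
  by rewrite mem_imset //; exact: can_inj fK.
have lineI l : line_in (proj_map M @: V) l -> line_in V (proj_map (invmx M) l).
  by move=> /(line_in_proj_map uN); rewrite backI.
split.
- move=> u u0; have [|v [v0 vO uv]] := span (u *m M).
    by apply: contraNneq u0 => uM0; rewrite -(mulmxK uM u) uM0 mul0mx.
  exists (M *m v); split; last by rewrite mulmxA.
    by apply: contraNneq v0 => Mv0; rewrite -(mulKmx uM v) Mv0 mulmx0.
  by have := imset_f (proj_map M) vO; rewrite /proj_map limg_line lfunE.
- move=> _ /imsetP[P PO ->]; have [ls [uls sls als]] := many P PO.
  exists (map (proj_map M) ls); split; first by rewrite map_inj_uniq //; exact: can_inj fK.
    by rewrite size_map.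
  rewrite all_map; apply: sub_all als => l /= /andP[lV Pl].
  by rewrite line_in_proj_map //= proj_mapS.
- move=> P ls PV PO uls als.
  rewrite -(size_map (proj_map (invmx M))); apply: (few (proj_map (invmx M) P)).
  + by rewrite -memI gK.
  + by rewrite -memI gK.
  + by rewrite map_inj_uniq //; exact: can_inj gK.
  rewrite all_map; apply: sub_all als => l /= /andP[lV Pl].
  by rewrite lineI //= proj_mapS.
- move=> l P Q lV PO QO Pl Ql; apply: (can_inj gK).
  apply: (cap (proj_map (invmx M) l)); rewrite ?lineI ?proj_mapS //.
    by rewrite -memI gK.
  by rewrite -memI gK.
Qed.

Lemma pointP P : reflect (exists2 v, v != 0 & P = <[v]>%VS) (P \in PG3 F).
Proof.
rewrite inE; apply: (iffP idP) => [dP|[v v0 ->]]; last by rewrite dim_vline v0.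
exists (vpick P).
  by rewrite vpick0 -dimv_eq0 (eqP dP).
apply/esym/eqP; rewrite eqEdim dim_vline -memvE memv_pick vpick0 -dimv_eq0 (eqP dP) //.
Qed.

Lemma vline_point v : v != 0 -> <[v]>%VS \in PG3 F.
Proof. by move=> v0; apply/pointP; exists v. Qed.

Lemma vline_eqP v w : v != 0 -> reflect (exists2 a, a != 0 & w = a *: v) (<[v]> == <[w]>)%VS.
Proof.
move=> v0; apply: (iffP eqP) => [e|[a a0 ->]].
  have : w \in <[v]>%VS by rewrite e memv_line.
  case/vlineP=> a wE; exists a => //; apply: contraNneq v0 => a0.
  by move: e; rewrite wE a0 scale0r => /(congr1 (@dimv _ _)); rewrite dimv0 dim_vline; case: eqP.
apply/eqP; rewrite eqEsubv -!memvE memvZ ?memv_line // andbT.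
by rewrite -[v in v \in _]scale1r -(mulVf a0) -scalerA memvZ ?memv_line.
Qed.

Lemma line_inP V l : reflect ((\dim l = 2)%N /\ forall v, v \in l -> v != 0 -> <[v]>%VS \in V)
  (line_in V l).
Proof.
apply: (iffP andP) => [[/eqP dl /subsetP lV]|[dl lV]]; split; rewrite ?dl //.
  by move=> v vl v0; apply: lV; rewrite inE vline_point // -memvE.
apply/subsetP=> P; rewrite inE => /andP[/pointP[v v0 ->]].
by rewrite -memvE => vl; apply: lV.
Qed.

Lemma dim_join v w : v != 0 -> w \notin <[v]>%VS -> (\dim (<[v]> + <[w]>) = 2)%N.
Proof.
move=> v0 wv; have w0 : w != 0 by apply: contraNneq wv => ->; rewrite mem0v.
rewrite dimv_disjoint_sum ?dim_vline ?v0 ?w0 //.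
apply/eqP; rewrite -subv0; apply/subvP=> u; rewrite memv_cap => /andP[uv /vlineP[a ua]].
rewrite memv0 ua; case: (eqVneq a 0) => [->|a0]; first by rewrite scale0r.
case/negP: wv; rewrite -[w]scale1r -(mulVf a0) -scalerA -ua memvZ //.
Qed.

Lemma join_eq l v w : (\dim l = 2)%N -> v \in l -> w \in l -> v != 0 -> w \notin <[v]>%VS ->
  l = (<[v]> + <[w]>)%VS.
Proof.
move=> dl vl wl v0 wv; apply/esym/eqP.
by rewrite eqEdim subv_add -!memvE vl wl dim_join ?dl.
Qed.

Lemma mem_join v w u : reflect (exists a b, u = a *: v + b *: w) (u \in <[v]> + <[w]>)%VS.
Proof.
apply: (iffP memv_addP) => [[_ /vlineP[a ->] [_ /vlineP[b ->] ->]]|[a [b ->]]].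
  by exists a, b.
by exists (a *: v); rewrite ?memvZ ?memv_line //; exists (b *: w); rewrite ?memvZ ?memv_line.
Qed.

Lemma line_spanning l v : (\dim l = 2)%N -> v \in l -> v != 0 ->
  exists2 w, w \in l & w \notin <[v]>%VS.
Proof.
move=> dl vl v0; have : ~~ (l <= <[v]>)%VS.
  by apply: contraTN isT => /dimvS; rewrite dl dim_vline v0.
by case/subvPn=> w wl wv; exists w.
Qed.

End Projectivities.

(** * Arithmetic of the field of order q^2 *)

Section HermitianGeometry.
Local Open Scope ring_scope.
Variables (F : finFieldType) (q k : nat).
Implicit Types x y : F.
Hypotheses (q_def : q = (2 * k + 1)%N) (k_gt0 : (0 < k)%N).

(** Here [k = (q - 1) / 2] and [k.+1 = (q + 1) / 2]; all later divisibility questions on exponents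
    of [xi] are settled with its order in this form. *)
Lemma order_half : (q ^ 2 - 1 = 2 * (2 * (k * k.+1)))%N.
Proof. rewrite q_def; nia. Qed.

Lemma q_gt2 : (2 < q)%N. Proof. by rewrite q_def; lia. Qed.

Hypothesis card_F : #|F| = (q ^ 2)%N.
Hypothesis frobD : forall x y : F, (x + y) ^+ q = x ^+ q + y ^+ q.

Lemma frobK x : (x ^+ q) ^+ q = x.
Proof. by rewrite -exprM mulnn -card_F expf_card. Qed.

Lemma frob0 : 0 ^+ q = 0 :> F.
Proof. by rewrite q_def addn1 expr0n. Qed.

Lemma frobN x : (- x) ^+ q = - x ^+ q.
Proof. by rewrite exprNn -signr_odd q_def oddD oddM /= expr1 mulN1r. Qed.

Lemma frobB x y : (x - y) ^+ q = x ^+ q - y ^+ q.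
Proof. by rewrite frobD frobN. Qed.

Lemma frob_sum I (r : seq I) (f : I -> F) : (\sum_(i <- r) f i) ^+ q = \sum_(i <- r) f i ^+ q.
Proof. by apply: (big_morph (fun x => x ^+ q)) => //; exact: frob0. Qed.

(** A nonzero polynomial has no more roots than its degree, and all [q ^ 2] field elements would be
    roots. *)
Lemma poly_vanish (f : {poly F}) : (size f <= q ^ 2)%N -> (forall s, f.[s] = 0) -> f = 0.
Proof.
move=> sf f0; apply: contraTeq sf => nz_f; rewrite -ltnNge -card_F cardE.
apply: max_poly_roots nz_f _ (enum_uniq F).
by apply/allP=> s _; rewrite rootE f0.
Qed.

(** These exponents occur when a Hermitian form or [G_eq] is restricted to a line. They are distinct
    and below [q ^ 2] because [q >= 3], so each coefficient vanishes. *)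
Lemma sparse_vanish (k0 k1 k2 kq kq1 k2q : F) :
    (forall s, k0 + k1 * s + k2 * s ^+ 2 + kq * s ^+ q + kq1 * s ^+ q.+1 + k2q * s ^+ (2 * q) = 0) ->
  [/\ k1 = 0, k2 = 0 & kq1 = 0].
Proof.
pose f := k0%:P + k1 *: 'X + k2 *: 'X^2 + kq *: 'X^q + kq1 *: 'X^(q.+1) + k2q *: 'X^(2 * q).
move=> fs; have f0 : f = 0.
  apply: poly_vanish => [|s]; last by rewrite !(hornerD, hornerZ, hornerXn, hornerX, hornerC) fs.
  have big (c : F) n : (n < q ^ 2)%N -> (size (c *: 'X^n) <= q ^ 2)%N.
    by move=> nq; rewrite (leq_trans (size_scale_leq _ _)) // size_polyXn.
  have [q1 q2 q3 q4 q5] : [/\ 1 < q ^ 2, 2 < q ^ 2, q < q ^ 2, q.+1 < q ^ 2 & 2 * q < q ^ 2]%N.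
    by rewrite q_def; split; nia.
  rewrite /f; do 4![rewrite (leq_trans (size_polyD _ _)) // geq_max big ?andbT //].
  rewrite (leq_trans (size_polyD _ _)) // geq_max.
  by rewrite -['X]expr1 big ?andbT ?(leq_trans (size_polyC_leq1 _)) // ltnW.
have c i : f`_i = 0 by rewrite f0 coef0.
split; [have := c 1%N|have := c 2%N|have := c q.+1]; rewrite !(coefD, coefZ, coefXn, coefX, coefC).
- have [-> -> -> ->] : [/\ (1 == 2) = false, (1 == q) = false, (1 == q.+1) = false & (1 == 2 * q) = false]%N.
    by rewrite q_def; split; lia.
  by rewrite eqxx !mulr0 !mulr1 !addr0 add0r.
- have [-> -> -> ->] : [/\ (2 == 1) = false, (2 == q) = false, (2 == q.+1) = false & (2 == 2 * q) = false]%N.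
    by rewrite q_def; split; lia.
  by rewrite eqxx !mulr0 !mulr1 !addr0 !add0r.
- have [-> -> -> ->] : [/\ (q.+1 == 1) = false, (q.+1 == 2) = false, (q.+1 == q) = false & (q.+1 == 2 * q) = false]%N.
    by rewrite q_def; split; lia.
  by rewrite eqxx !mulr0 !mulr1 !addr0 !add0r.
Qed.

Hypothesis q_eq0 : q%:R = 0 :> F.

(** Twice [k.+1] is [q + 1], and [q] is zero in [F]. *)
Lemma half_eq1 : k.+1%:R *+ 2 = 1 :> F.
Proof.
by rewrite -mulrnA (_ : k.+1 * 2 = q.+1)%N ?mulrS ?q_eq0 ?addr0 // q_def; lia.
Qed.

Lemma two_neq0 : 2%:R != 0 :> F.
Proof.
by apply/eqP=> e; have /eqP := half_eq1; rewrite -mulr_natr e mulr0 eq_sym oner_eq0.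
Qed.

Lemma half_neq0 : k.+1%:R != 0 :> F.
Proof. by apply: contra_eq_neq half_eq1 => ->; rewrite mul0rn eq_sym oner_neq0. Qed.

Lemma eq_opp_eq0 x : x = - x -> x = 0.
Proof.
move/eqP; rewrite -subr_eq0 opprK -mulr2n -mulr_natl mulf_eq0 (negPf two_neq0) => /eqP.
by [].
Qed.

Variable xi : F.
Hypothesis xi_prim : (q ^ 2 - 1)%N.-primitive_root xi.

Lemma xi_neq0 : xi != 0.
Proof.
apply/eqP=> xi0; have := prim_expr_order xi_prim; rewrite xi0 order_half expr0n.
by rewrite (_ : (_ == 0)%N = false) ?(@eqP _ 0) //; [move/eqP; rewrite eq_sym oner_eq0 | nia].
Qed.

Lemma xi_expr_eq1 n : (xi ^+ n == 1) = (2 * (2 * (k * k.+1)) %| n)%N.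
Proof. by rewrite -(prim_order_dvd xi_prim) order_half. Qed.

Lemma xi_half : xi ^+ (2 * (k * k.+1)) = -1.
Proof.
have : (xi ^+ (2 * (k * k.+1))) ^+ 2 == 1 by rewrite -exprM xi_expr_eq1 mulnC.
rewrite sqrf_eq1 => /orP[|/eqP//]; rewrite xi_expr_eq1 => /dvdn_leq; nia.
Qed.

Lemma xi_exprq : xi ^+ q = xi ^+ (2 * k) * xi.
Proof. by rewrite -exprSr q_def addn1. Qed.

Lemma xi_frob : xi ^+ q != xi.
Proof.
rewrite xi_exprq -subr_eq0 -[X in _ - X]mul1r -mulrBl mulf_eq0 (negPf xi_neq0) orbF subr_eq0 xi_expr_eq1.
by apply/negP=> /dvdn_leq; nia.
Qed.

(** For [theta = xi ^+ k.+1], the power [theta ^+ (q - 1)] is [xi] raised to half its order, which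
    is -1. *)
Lemma frob_antifixed : exists2 theta : F, theta != 0 & theta ^+ q = - theta.
Proof.
exists (xi ^+ k.+1); first by rewrite expf_neq0 ?xi_neq0.
rewrite -mulN1r -xi_half -exprM -exprD; congr (_ ^+ _); rewrite q_def; lia.
Qed.

(* [vector.coord] and mathcomp's [sesqui] shadow the ones of [Defs]. *)
Local Notation coord := Defs.coord.
Local Arguments vec4 {F} (a b c d)%_R.
Local Notation space := {vspace 'cV[F]_4}.
Implicit Types (P Q l pi : space) (V O S L : {set space}) (u v w r z : 'cV[F]_4).

Lemma coord_vec4 (a b c d : F) :
  ((coord (vec4 a b c d) 0 = a) * (coord (vec4 a b c d) 1 = b) *
   (coord (vec4 a b c d) 2 = c) * (coord (vec4 a b c d) 3 = d))%type.
Proof. by rewrite /coord !mxE !inordK. Qed.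

Lemma coordD v w i : coord (v + w) i = coord v i + coord w i.
Proof. by rewrite /coord mxE. Qed.

Lemma coordZ a v i : coord (a *: v) i = a * coord v i.
Proof. by rewrite /coord mxE. Qed.

Lemma coord_inj v w : coord v 0 = coord w 0 -> coord v 1 = coord w 1 ->
  coord v 2 = coord w 2 -> coord v 3 = coord w 3 -> v = w.
Proof.
move=> e0 e1 e2 e3; apply/matrixP=> i j; rewrite [j]ord1.
rewrite -[i]inord_val; case: i => [[|[|[|[|i]]]] lti] //=.
Qed.

Lemma coord0 i : coord (0 : 'cV[F]_4) i = 0.
Proof. by rewrite /coord mxE. Qed.

Lemma sum_ord4 (f : 'I_4 -> F) :
  \sum_i f i = f (inord 0) + f (inord 1) + f (inord 2) + f (inord 3).
Proof.
rewrite !big_ord_recl big_ord0 addr0 !addrA.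
by congr (f _ + f _ + f _ + f _); apply: val_inj; rewrite /= inordK.
Qed.

Lemma vec4_eta v : v = vec4 (coord v 0) (coord v 1) (coord v 2) (coord v 3).
Proof. by apply: coord_inj; rewrite coord_vec4. Qed.

Lemma vec4_eq0 (a b c d : F) :
  (vec4 a b c d == 0) = [&& a == 0, b == 0, c == 0 & d == 0].
Proof.
apply/eqP/and4P => [e|[/eqP-> /eqP-> /eqP-> /eqP->]].
  by move: (coord_vec4 a b c d); rewrite e !coord0 => -[[[<- <-] <-] <-]; rewrite eqxx.
by apply: coord_inj; rewrite coord_vec4 coord0.
Qed.

Lemma vline_vec4_inj (x y z x' y' z' : F) :
  <[vec4 1 x y z]>%VS = <[vec4 1 x' y' z']>%VS -> [/\ x' = x, y' = y & z' = z].
Proof.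
move=> /eqP/vline_eqP[]; first by rewrite vec4_eq0 oner_eq0.
move=> a _ e; have := congr1 (fun v : 'cV[F]_4 => coord v 0) e; rewrite coordZ !coord_vec4 mulr1 => a1.
by split; [have := congr1 (fun v : 'cV[F]_4 => coord v 1) e|have := congr1 (fun v : 'cV[F]_4 => coord v 2) e|
  have := congr1 (fun v : 'cV[F]_4 => coord v 3) e]; rewrite coordZ !coord_vec4 -a1 mul1r.
Qed.

(** * Sets of type V1, V2 and V3 *)

Lemma configuration_not_type_V3 V O : configuration V O -> ~ type_V3 q V.
Proof.
move=> [_ _ few cap] [S [L [[M uM SE] lines deg VE]]].
have lV l : l \in L -> line_in V l.
  move=> lL; have [dl _] := lines l lL; rewrite /line_in dl /= VE.
  exact: (bigcup_sup l).
(* More than two lines of [V] pass through [P], so [conf_few] forces [P] into [O]. *)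
have SO P : P \in S -> P \in O.
  move=> PS; have cardP := deg P PS; apply: contraT => PO.
  have PV : P \in V.
    have [l] : exists l, l \in [set l in L | (P <= l)%VS] by apply/card_gt0P; rewrite cardP.
    rewrite inE => /andP[lL Pl]; rewrite VE; apply/bigcupP; exists l => //.
    rewrite inE Pl andbT; move: PS; rewrite SE => /imsetP[P0 /imsetP[v]].
    rewrite !inE => /andP[v0 _] -> ->; rewrite dim_proj_map // dim_vline v0 //.
  have := few P (enum [set l in L | (P <= l)%VS]) PV PO (enum_uniq _).
  rewrite -cardE cardP leqNgt ltnS ltnW ?q_gt2 //.
  suff -> : all (fun l => line_in V l && (P <= l)%VS) (enum [set l in L | (P <= l)%VS]) by move=> /(_ isT).
  by apply/allP=> l; rewrite mem_enum inE => /andP[lL ->]; rewrite lV.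
(* The all-ones vector is fixed by Frobenius, so [S] is not empty. *)
have [P PS] : exists P, P \in S.
  pose v : 'cV[F]_4 := const_mx 1.
  exists (proj_map M <[v]>%VS); rewrite SE imset_f //; apply/imsetP; exists v => //.
  rewrite inE; apply/andP; split; last by apply/eqP/matrixP=> i j; rewrite !mxE expr1n.
  by apply/eqP=> /matrixP/(_ ord0 ord0)/eqP; rewrite !mxE oner_eq0.
have [l] : exists l, l \in [set l in L | (P <= l)%VS] by apply/card_gt0P; rewrite deg.
rewrite inE => /andP[lL Pl]; have [_ cardl] := lines l lL.
have /card_gt1P[Q1 [Q2 [Q1l Q2l /eqP[]]]] : (1 < #|points_of l :&: S|)%N.
  by rewrite cardl ltnS (ltn_trans _ q_gt2).
move: Q1l Q2l; rewrite !inE => /andP[/andP[_ Q1l] Q1S] /andP[/andP[_ Q2l] Q2S].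
by apply: (cap l); rewrite ?lV ?SO.
Qed.

Lemma mem_type_V2 (alpha beta x y z : F) V :
  V = [set <[vec4 1 w.1.1 w.1.2 w.2]>%VS
               | w : F * F * F & G_eq q alpha beta w.1.1 w.1.2 w.2 == 0]
              :|: [set <[vec4 0 w.1.1 w.1.2 w.2]>%VS
                     | w : F * F * F
                     & (w != (0, 0, 0))
                       && (w.1.1 ^+ q.+1 + w.1.2 ^+ q.+1 == 0)] ->
  <[vec4 1 x y z]>%VS \in V -> G_eq q alpha beta x y z = 0.
Proof.
move=> ->; rewrite inE => /orP[] /imsetP[[[x' y'] z']]; rewrite inE /=.
  by move=> /eqP G0 /vline_vec4_inj[<- <- <-].
move=> _ /eqP/vline_eqP[]; first by rewrite vec4_eq0 oner_eq0.
move=> a a0 /(congr1 (fun v : 'cV[F]_4 => coord v 0)); rewrite coordZ !coord_vec4 mulr1 => /esym/eqP.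
by rewrite (negPf a0).
Qed.

(* The coefficients of [s] and [s ^+ 2] in [G_eq] along a line leave at most two
   directions, since [b ^+ 2 = -1]. *)
Lemma type_V2_line (alpha beta x y z a b c : F) : alpha != 0 ->
  (forall s, G_eq q alpha beta (x + s * a) (y + s * b) (z + s * c) = 0) ->
  a ^+ 2 + b ^+ 2 = 0 /\
  c = - (2%:R * alpha * (x * a + y * b)) - (beta ^+ q - beta) * (x ^+ q * a + y ^+ q * b).
Proof.
move=> alpha0 G0; set d := beta ^+ q - beta.
have [] := @sparse_vanish (G_eq q alpha beta x y z)
  (- c - 2%:R * alpha * (x * a + y * b) - d * (x ^+ q * a + y ^+ q * b))
  (- alpha * (a ^+ 2 + b ^+ 2))
  (c ^+ q + 2%:R * alpha ^+ q * (x ^+ q * a ^+ q + y ^+ q * b ^+ q) - d * (x * a ^+ q + y * b ^+ q))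
  (- d * (a * a ^+ q + b * b ^+ q))
  (alpha ^+ q * (a ^+ q * a ^+ q + b ^+ q * b ^+ q)).
  move=> s; rewrite -[RHS](G0 s) /G_eq -/d ![(2 * q)%N]mulnC !exprM !exprS !frobD !exprMn.
  by ring.
move=> c1 c2 _; split.
  by apply/eqP; move/eqP: c2; rewrite mulf_eq0 oppr_eq0 (negPf alpha0).
by apply/eqP; rewrite -subr_eq0 -oppr_eq0 -[X in _ == X]c1; apply/eqP; ring.
Qed.

Lemma configuration_not_type_V2 V O : configuration V O -> ~ type_V2 q V.
Proof.
move=> [span many _ _] [alpha [beta [alpha0 _ _ VE]]].
(* The plane avoided is the one at infinity, so [O] has an affine point, normalized below to
   [(1, x, y, z)]. *)
have [|v [v0 vO]] := span (delta_mx 0 (inord 0)).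
  by apply/eqP=> /matrixP/(_ 0 (inord 0))/eqP; rewrite !mxE !eqxx oner_eq0.
rewrite -rowE => rv0; have {rv0} c0 : coord v 0 != 0.
  by apply: contraNneq rv0 => c0; apply/eqP/matrixP=> i j; rewrite [j]ord1 !mxE; exact: c0.
pose x := coord v 1 / coord v 0; pose y := coord v 2 / coord v 0; pose z := coord v 3 / coord v 0.
have vE : <[v]>%VS = <[vec4 1 x y z]>%VS.
  apply/eqP/vline_eqP => //; exists (coord v 0)^-1; first by rewrite invr_neq0.
  by apply: coord_inj; rewrite coordZ coord_vec4 ?mulVf // mulrC.
rewrite {}vE in vO; set x1 := vec4 1 x y z in vO.
(* The last component that [type_V2_line] forces on a direction [(1, b)]. *)
pose phi b := - (2%:R * alpha * (x + y * b)) - (beta ^+ q - beta) * (x ^+ q + y ^+ q * b).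
have dir l : line_in V l && (<[x1]> <= l)%VS -> exists b, b ^+ 2 = -1 /\
    l = (<[x1]> + <[vec4 0 1 b (phi b)]>)%VS.
  case/andP=> /line_inP[dl lV]; rewrite -memvE => x1l.
  have x10 : x1 != 0 by rewrite vec4_eq0 oner_eq0.
  have [w wl wx1] := line_spanning dl x1l x10.
  pose w' := w - coord w 0 *: x1.
  have w'l : w' \in l by rewrite memvB // memvZ.
  have w'x1 : w' \notin <[x1]>%VS.
    apply: contra wx1 => w'x; rewrite -[w](subrK (coord w 0 *: x1)) memvD // memvZ ?memv_line //.
  set a := coord w' 1; set b := coord w' 2; set c := coord w' 3.
  have w'E : w' = vec4 0 a b c.
    apply: coord_inj; rewrite coord_vec4 //.
    by rewrite /w' coordD -scaleNr coordZ coord_vec4 mulr1 subrr.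
  have [|ab cE] := @type_V2_line alpha beta x y z a b c alpha0.
    move=> s; apply: (mem_type_V2 VE).
    have -> : vec4 1 (x + s * a) (y + s * b) (z + s * c) = x1 + s *: w'.
      by apply: coord_inj; rewrite coordD coordZ w'E !coord_vec4 ?mulr0 ?addr0.
    apply: lV; first by rewrite memvD // memvZ.
    apply/eqP=> /(congr1 (fun v : 'cV[F]_4 => coord v 0)).
    by rewrite coordD coordZ w'E !coord_vec4 coord0 mulr0 addr0 => /eqP; rewrite oner_eq0.
  have a0 : a != 0.
    apply: contraNneq w'x1 => a0; move: ab; rewrite w'E cE a0 expr0n add0r => /eqP.
    by rewrite sqrf_eq0 => /eqP->; rewrite !mulr0 !addr0 !mulr0 oppr0 addr0 (_ : vec4 _ _ _ _ = 0) ?mem0v //;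
      apply/eqP; rewrite vec4_eq0 eqxx.
  exists (b / a); split.
    rewrite expr_div_n; apply: (mulIf (expf_neq0 2 a0)); rewrite divfK ?expf_neq0 //.
    by rewrite mulN1r; apply/eqP; rewrite -addr_eq0 addrC ab.
  have -> : vec4 0 1 (b / a) (phi (b / a)) = a^-1 *: w'.
    rewrite w'E; apply: coord_inj; rewrite coordZ !coord_vec4 ?mulr0 ?mulVf // 1?mulrC //.
    by rewrite cE /phi; field.
  apply: (join_eq dl) => //; first by rewrite memvZ.
  by apply: contra w'x1 => /(memvZ a); rewrite scalerA mulfV // scale1r.
have [ls [uls sls als]] := many _ vO.
case: ls uls sls als => [|l1 [|l2 [|l3 []]]] //= /and3P[]; rewrite !inE !negb_or => /andP[l12 l13] l23 _ _.
case/and4P=> /dir[b1 [b1E l1E]] /dir[b2 [b2E l2E]] /dir[b3 [b3E l3E]] _.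
have b12 : b1 != b2 by apply: contra_neq l12 => e; rewrite l1E l2E e.
have b13 : b1 != b3 by apply: contra_neq l13 => e; rewrite l1E l3E e.
have b23 : b2 != b3 by apply: contra_neq l23 => e; rewrite l2E l3E e.
have /eqP : b2 ^+ 2 = b1 ^+ 2 by rewrite b2E b1E.
rewrite eqf_sqr eq_sym (negPf b12) => /eqP b2N.
have /eqP : b3 ^+ 2 = b1 ^+ 2 by rewrite b3E b1E.
rewrite eqf_sqr eq_sym (negPf b13) => /eqP b3N.
by case/eqP: b23; rewrite b2N b3N.
Qed.

(** * The Hermitian form of a matrix, and sets of type V1 *)

Section Sesquilinear.
Variable A : 'M[F]_4.
Hypothesis A_herm : nondeg_hermitian q A.
Local Notation h := (Defs.sesqui q A).

Lemma frob_mxD u v : frob_mx q (u + v) = frob_mx q u + frob_mx q v.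
Proof. by apply/matrixP=> i j; rewrite !mxE frobD. Qed.

Lemma frob_mxZ a v : frob_mx q (a *: v) = a ^+ q *: frob_mx q v.
Proof. by apply/matrixP=> i j; rewrite !mxE exprMn. Qed.

Lemma frob_mx_eq0 v : (frob_mx q v == 0) = (v == 0).
Proof.
apply/eqP/eqP => [/matrixP e|->]; apply/matrixP=> i j; rewrite !mxE ?frob0 //.
by apply/eqP; have /eqP := e i j; rewrite !mxE expf_eq0 => /andP[].
Qed.

Lemma sesquiDl u v w : h (u + v) w = h u w + h v w.
Proof. by rewrite /Defs.sesqui frob_mxD linearD /= !mulmxDl mxE. Qed.

Lemma sesquiDr u v w : h w (u + v) = h w u + h w v.
Proof. by rewrite /Defs.sesqui mulmxDr mxE. Qed.

Lemma sesquiZl a u w : h (a *: u) w = a ^+ q * h u w.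
Proof. by rewrite /Defs.sesqui frob_mxZ linearZ /= -!scalemxAl mxE. Qed.

Lemma sesquiZr a u w : h w (a *: u) = a * h w u.
Proof. by rewrite /Defs.sesqui -scalemxAr mxE. Qed.

Lemma sesqui_sym u v : h v u = h u v ^+ q.
Proof.
have /andP[_ /eqP AE] := A_herm; rewrite /Defs.sesqui.
(* A 1x1 matrix equals its transpose, and transposing reverses the order of the factors. *)
transitivity ((((frob_mx q u)^T *m A *m v)^T) 0 0 ^+ q); last by rewrite mxE.
rewrite !trmx_mul trmxK mulmxA.
rewrite !mxE frob_sum; apply: eq_bigr => i _; rewrite exprMn !mxE frobK frob_sum; congr (_ * _).
apply: eq_bigr => j _; rewrite !mxE exprMn; congr (_ * _).
by rewrite -[in LHS]AE !mxE.
Qed.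

Lemma mem_herm_surface v : (<[v]>%VS \in herm_surface q A) = (v != 0) && (h v v == 0).
Proof.
rewrite !inE dim_vline eqb1; case: (v != 0) => //=; apply/forallP/eqP => [/(_ v)|hv w].
  by rewrite memv_line /= => /eqP.
by apply/implyP=> /vlineP[a ->]; rewrite sesquiZl sesquiZr hv !mulr0.
Qed.

End Sesquilinear.
Lemma configuration_not_type_V1 V O : configuration V O -> ~ type_V1 q V.
Proof.
move=> [span many few cap] [A [P [pi [L [Aherm [PH _ Ppi] _ Llines VE]]]]].
pose h := Defs.sesqui q A; have hsym u v : h v u = h u v ^+ q by exact: sesqui_sym.
have [p p0 PE] : exists2 p, p != 0 & P = <[p]>%VS by apply/pointP; move: PH; rewrite inE => /andP[].
rewrite {P}PE mem_herm_surface // p0 /= -/h in PH Ppi Llines VE; move/eqP: PH => hpp.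
have hpi v : v \in pi -> h p v = 0 by apply: Ppi; exact: memv_line.
(* Off the tangent plane [V] is the Hermitian surface: the lines of [L] lie in [pi], and the
   generators through [p] are polar to [p]. *)
have offplane v : h p v != 0 -> (<[v]>%VS \in V) = (h v v == 0).
  move=> hpv; have v0 : v != 0.
    by apply: contraNneq hpv => ->; rewrite /h -(scale0r 0) sesquiZr mul0r.
  have nL : <[v]>%VS \notin \bigcup_(l in L) points_of l.
    apply: contraNN hpv => /bigcupP[l /Llines[_ _ lpi]]; rewrite inE => /andP[_ vl].
    by apply/eqP/hpi; rewrite memvE (subv_trans vl).
  rewrite VE in_setU (negPf nL) in_setD mem_herm_surface // v0 /= -/h.
  case: eqP => [hvv|]; rewrite ?andbF // andbT.
  apply: contra hpv => /bigcupP[g]; rewrite inE => /and3P[dg pg /subsetP gH].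
  rewrite !inE -!memvE in pg * => /andP[_ vg].
  have hzero s : h (p + s *: v) (p + s *: v) = 0.
    case: (eqVneq (p + s *: v) 0) => [->|nz]; first by rewrite /h -(scale0r 0) sesquiZr mul0r.
    have : <[p + s *: v]>%VS \in herm_surface q A.
      by apply: gH; rewrite inE vline_point // -memvE memvD // memvZ.
    by rewrite mem_herm_surface // nz => /eqP.
  (* On the points [p + s *: v] of a generator the form is [h p v * s + h v p * s ^+ q], which
     vanishes for every [s]. *)
  have [] := @sparse_vanish 0 (h p v) 0 (h v p) 0 0.
    move=> s; have := hzero s; rewrite /h !(sesquiDl, sesquiDr, sesquiZl, sesquiZr) -/h hpp hvv.
    by move=> e; rewrite -[RHS]e; ring.
  by move=> ->.
(* This row vector is the functional [h p], so [x] is a point of [O] off the tangent plane. *)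
have [|x [x0 xO]] := span ((frob_mx q p)^T *m A).
  have /andP[uA _] := Aherm; apply: contraNneq p0 => e.
  by rewrite -frob_mx_eq0 // -[frob_mx q p]trmxK -[(frob_mx q p)^T](mulmxK uA) e mul0mx trmx0.
move=> hpx'; have {hpx'} hpx : h p x != 0.
  apply: contraNneq hpx' => e; apply/eqP/matrixP=> i j; rewrite [i]ord1 [j]ord1 [RHS]mxE.
  exact: e.
have [ls [_ sls als]] := many _ xO.
case: ls sls als => [|m ls] //= _ /andP[/andP[mV]]; rewrite -memvE => xm _.
have [dm mV'] := line_inP _ _ mV.
have hxx : h x x = 0 by apply/eqP; rewrite -offplane // mV'.
have [w wm wx] := line_spanning dm xm x0.
(* The point where [m] meets the tangent plane. *)
pose y := w - (h p w / h p x) *: x.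
have ym : y \in m by rewrite memvB // memvZ.
have yx : y \notin <[x]>%VS.
  by apply: contra wx => yx; rewrite -[w](subrK ((h p w / h p x) *: x)) memvD // memvZ // memv_line.
have y0 : y != 0 by apply: contraNneq yx => ->; rewrite mem0v.
have hpy : h p y = 0.
  by rewrite /y -scaleNr /h sesquiDr sesquiZr -/h mulNr divfK // subrr.
(* All points [x + s *: y] of [m] are off the tangent plane, hence isotropic; compare the
   coefficients of [s] and [s ^+ q.+1]. *)
clearbody y; have [hxy hyy] : h x y = 0 /\ h y y = 0.
  have [|] := @sparse_vanish 0 (h x y) 0 (h y x) (h y y) 0; last by move=> -> _ ->.
  move=> s; have hps : h p (x + s *: y) = h p x.
    by rewrite /h sesquiDr sesquiZr -/h hpy mulr0 addr0.
  have : h (x + s *: y) (x + s *: y) == 0.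
    rewrite -offplane ?hps // mV' ?memvD ?memvZ //.
    by apply: contraNneq hpx => e; rewrite -hps e /h -(scale0r 0) sesquiZr mul0r.
  rewrite /h !(sesquiDl, sesquiDr, sesquiZl, sesquiZr) -/h hxx => /eqP e.
  by rewrite -[RHS]e (exprS s q); ring.
have hyp : h y p = 0 by rewrite hsym hpy frob0.
have hyx : h y x = 0 by rewrite hsym hxy frob0.
have yp : y \notin <[p]>%VS.
  apply/negP=> /vlineP[a ya]; move: hyx y0; rewrite ya /h sesquiZl -/h => /eqP.
  by rewrite mulf_eq0 (negPf hpx) orbF expf_eq0 => /andP[_ /eqP->]; rewrite scale0r eqxx.
pose g := (<[p]> + <[y]>)%VS.
have pg : p \in g by rewrite memvE addvSl.
have yg : y \in g by rewrite memvE addvSr.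
have dg : (\dim g = 2)%N by apply: dim_join.
have gP v : v \in g -> h p v = 0 /\ h v v = 0.
  case/mem_join=> a [b ->]; rewrite /h !(sesquiDl, sesquiDr, sesquiZl, sesquiZr) -/h.
  by rewrite hpp hpy hyp hyy !mulr0 !addr0 !mulr0 addr0.
(* As [y] is in [V], either it is on a line of [L], which is then [g], or it is on no generator
   through [p]; but [g] is such a generator. *)
have gL : g \in L.
  have : <[y]>%VS \in V by apply: mV'.
  rewrite VE in_setU => /orP[/bigcupP[l lL]|].
    rewrite inE -memvE => /andP[_ yl]; have [dl pl _] := Llines l lL.
    by rewrite /g -(join_eq dl (_ : p \in l) yl) // memvE.
  rewrite in_setD => /andP[/bigcupP[]]; exists g; last by rewrite inE vline_point // -memvE.
  rewrite inE dg eqxx -memvE pg /=; apply/subsetP=> Q; rewrite inE => /andP[/pointP[u u0 ->]].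
  by rewrite -memvE => /gP[_ hv]; rewrite mem_herm_surface // u0 -/h hv eqxx.
have gV : line_in V g.
  by rewrite /line_in dg eqxx VE /=; apply/(subset_trans (bigcup_sup g gL))/subsetUl.
have [theta theta0 thetaq] := frob_antifixed.
(* With this [b] the cross terms [b * h x p] and [b ^+ q * h p x] are [theta] and
   [theta ^+ q = - theta], so [t] is isotropic. *)
pose b := theta / h p x ^+ q; pose t := x + b *: p.
have hpx_q : h p x ^+ q != 0 by rewrite expf_neq0.
have b0 : b != 0 by rewrite mulf_neq0 ?invr_neq0.
have hpt : h p t = h p x by rewrite /t /h sesquiDr sesquiZr -/h hpp mulr0 addr0.
have htt : h t t = 0.
  rewrite /t /h !(sesquiDl, sesquiDr, sesquiZl, sesquiZr) -/h hxx hpp (hsym p x).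
  by rewrite /b expr_div_n frobK thetaq !mulr0 addr0 add0r divfK // divfK // subrr.
have hyt : h y t = 0 by rewrite /t /h sesquiDr sesquiZr -/h hyp hyx mulr0 addr0.
have hty : h t y = 0 by rewrite hsym hyt frob0.
have ty : t \notin <[y]>%VS.
  apply/negP=> /vlineP[a ta]; case/eqP: hpx; rewrite -hpt ta /h sesquiZr -/h hpy mulr0 //.
have tE : t = x + b *: p by [].
clearbody t; pose n := (<[y]> + <[t]>)%VS.
have tn : t \in n by rewrite memvE addvSr.
have yn : y \in n by rewrite memvE addvSl.
(* Apart from [y], which is in [V], the points of [n] are isotropic and off the tangent plane. *)
have nV : line_in V n.
  apply/line_inP; split; first exact: dim_join.
  move=> v /mem_join[a [c ->]] v0; case: (eqVneq c 0) v0 => [->|c0 _].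
    rewrite scale0r addr0 scaler_eq0 negb_or => /andP[a0 _].
    suff -> : <[a *: y]>%VS = <[y]>%VS by apply: mV'.
    by apply/esym/eqP/vline_eqP => //; exists a.
  rewrite offplane /h !(sesquiDl, sesquiDr, sesquiZl, sesquiZr) -/h.
    by rewrite hyy hyt hty htt !(mulr0, addr0).
  by rewrite hpy hpt mulr0 add0r mulf_neq0.
have xg : x \notin g by apply: contra hpx => /gP[-> _].
have tg : t \notin g by apply: contra hpx => /gP[]; rewrite hpt => ->.
have xn : x \notin n.
  apply/negP=> /mem_join[a [c xE]].
  have c1 : c = 1.
    have : h p x = c * h p x.
      by rewrite [in LHS]xE /h !(sesquiDr, sesquiZr) -/h hpy hpt mulr0 add0r.
    by rewrite -{1}[h p x]mul1r => /(mulIf hpx).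
  have ay : a *: y = - (b *: p).
    apply/eqP; rewrite -addr_eq0; apply/eqP/(addrI x).
    by rewrite addr0 addrCA -tE -[t]scale1r -c1 -xE.
  case/negP: yp; case: (eqVneq a 0) ay => [->|a0 ay].
    by move/eqP; rewrite scale0r eq_sym oppr_eq0 scaler_eq0 (negPf b0) (negPf p0).
  rewrite -[y]scale1r -(mulVf a0) -scalerA ay.
  by rewrite memvZ // memvN memvZ // memv_line.
have uls : uniq [:: m; g; n].
  rewrite /= !inE negb_or andbT; apply/andP; split; first apply/andP; first split.
  - by apply: contraNneq xg => <-.
  - by apply: contraNneq xn => <-.
  - by apply: contraNneq tg => ->.
have als : all (fun l => line_in V l && (<[y]> <= l)%VS) [:: m; g; n].
  by rewrite /= mV gV nV -!memvE ym yg yn.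
have yV : <[y]>%VS \in V by apply: mV'.
(* Three lines of [V] through [y] put it in [O]; then [x] and [y] are two points of [O] on [m]. *)
case yO: (<[y]>%VS \in O); last by have := few _ _ yV (negbT yO) uls als.
by case/negP: yx; rewrite (cap m _ _ mV xO yO) ?memv_line // -memvE.
Qed.
(** * Quadratic and Hermitian forms, and the group K *)

Definition polar u v : F :=
  coord u 0 * coord v 3 + coord u 3 * coord v 0 - coord u 1 * coord v 2 - coord u 2 * coord v 1.

Definition quad v : F := coord v 0 * coord v 3 - coord v 1 * coord v 2.

Definition herm u v : F :=
  coord u 0 ^+ q * coord v 3 + coord u 3 ^+ q * coord v 0
    - coord u 1 ^+ q * coord v 1 - coord u 2 ^+ q * coord v 2.

Lemma F_eqE g v : F_eq q g v = herm v v - g * quad v ^+ k.+1.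
Proof.
rewrite /F_eq /herm_eq /herm /quad (_ : q.+1 %/ 2 = k.+1)%N; last by rewrite q_def; lia.
by rewrite !exprS; ring.
Qed.

Lemma quadD u v : quad (u + v) = quad u + polar u v + quad v.
Proof. by rewrite /quad /polar !coordD; ring. Qed.

Lemma quadZ a v : quad (a *: v) = a ^+ 2 * quad v.
Proof. by rewrite /quad !coordZ; ring. Qed.

Lemma polarC u v : polar u v = polar v u.
Proof. by rewrite /polar; ring. Qed.

Lemma polarDl u v w : polar (u + v) w = polar u w + polar v w.
Proof. by rewrite /polar !coordD; ring. Qed.

Lemma polarZl a v w : polar (a *: v) w = a * polar v w.
Proof. by rewrite /polar !coordZ; ring. Qed.

Lemma polar_quad v : polar v v = 2%:R * quad v.
Proof. by rewrite /polar /quad; ring. Qed.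

Lemma hermDl u v w : herm (u + v) w = herm u w + herm v w.
Proof. by rewrite /herm !coordD !frobD; ring. Qed.

Lemma hermDr u v w : herm w (u + v) = herm w u + herm w v.
Proof. by rewrite /herm !coordD; ring. Qed.

Lemma hermZl a v w : herm (a *: v) w = a ^+ q * herm v w.
Proof. by rewrite /herm !coordZ !exprMn; ring. Qed.

Lemma hermZr a v w : herm w (a *: v) = a * herm w v.
Proof. by rewrite /herm !coordZ; ring. Qed.

Lemma herm_frob v : herm v v ^+ q = herm v v.
Proof. by rewrite /herm !frobB frobD !exprMn !frobK; ring. Qed.

Lemma F_eqZ g a v : F_eq q g (a *: v) = a ^+ q.+1 * F_eq q g v.
Proof.
rewrite !F_eqE hermZl hermZr quadZ exprMn -exprM (_ : 2 * k.+1 = q.+1)%N; last by rewrite q_def; lia.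
by rewrite !exprS; ring.
Qed.

Lemma mem_zeros_F_eq g v : (<[v]>%VS \in zeros (F_eq q g)) = (v != 0) && (F_eq q g v == 0).
Proof.
rewrite !inE dim_vline eqb1; case: (v != 0) => //=; apply/forallP/eqP => [/(_ v)|hv w].
  by rewrite memv_line /= => /eqP.
by apply/implyP=> /vlineP[a ->]; rewrite F_eqZ hv mulr0.
Qed.

(** If [v] is read as the matrix X with rows [(x, y)] and [(z, t)], then [kron q A] acts by X -> A^q
    X A^T. *)
Lemma coord_kron (A : 'M[F]_2) v :
  let: a := A 0 0 in let: b := A 0 1 in let: c := A 1 0 in let: d := A 1 1 in
  let: x := coord v 0 in let: y := coord v 1 in let: z := coord v 2 in let: t := coord v 3 in
  [/\ coord (kron q A *m v) 0 = a ^+ q * (a * x + b * y) + b ^+ q * (a * z + b * t),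
      coord (kron q A *m v) 1 = a ^+ q * (c * x + d * y) + b ^+ q * (c * z + d * t),
      coord (kron q A *m v) 2 = c ^+ q * (a * x + b * y) + d ^+ q * (a * z + b * t) &
      coord (kron q A *m v) 3 = c ^+ q * (c * x + d * y) + d ^+ q * (c * z + d * t)].
Proof.
have kE (i j : 'I_4) (i1 i2 j1 j2 : 'I_2) : (i %/ 2 = i1)%N -> (i %% 2 = i2)%N ->
    (j %/ 2 = j1)%N -> (j %% 2 = j2)%N -> kron q A i j = A i1 j1 ^+ q * A i2 j2.
  move=> e1 e2 f1 f2; rewrite !mxE.
  by congr (A _ _ ^+ q * A _ _); apply: val_inj.
have rowE (i : nat) (i1 i2 : 'I_2) : (i < 4)%N -> (i %/ 2 = i1)%N -> (i %% 2 = i2)%N ->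
    coord (kron q A *m v) i = A i1 0 ^+ q * (A i2 0 * coord v 0 + A i2 1 * coord v 1)
       + A i1 1 ^+ q * (A i2 0 * coord v 2 + A i2 1 * coord v 3).
  move=> lti e1 e2; rewrite {1}/coord mxE sum_ord4.
  rewrite (@kE _ _ i1 i2 0 0) ?inordK // (@kE _ _ i1 i2 0 1) ?inordK //.
  rewrite (@kE _ _ i1 i2 1 0) ?inordK // (@kE _ _ i1 i2 1 1) ?inordK //.
  by rewrite /coord; ring.
by rewrite (rowE 0%N 0 0) // (rowE 1%N 0 1) // (rowE 2%N 1 0) // (rowE 3%N 1 1).
Qed.

Lemma det_mx2 (A : 'M[F]_2) : \det A = A 0 0 * A 1 1 - A 0 1 * A 1 0.
Proof.
rewrite (expand_det_row A 0) !big_ord_recl big_ord0 /cofactor !det_mx11 !mxE /= addr0 expr0 mul1r.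
have -> : lift 0 0 = 1 :> 'I_2 by exact: val_inj.
have -> : lift 1 0 = 0 :> 'I_2 by exact: val_inj.
by rewrite expr1 mulN1r mulrN.
Qed.

Definition mx2 (a b c d : F) : 'M[F]_2 :=
  \matrix_(i < 2, j < 2) (if i == 0 then if j == 0 then a else b else if j == 0 then c else d).

Lemma mx2E (a b c d : F) :
  [/\ mx2 a b c d 0 0 = a, mx2 a b c d 0 1 = b, mx2 a b c d 1 0 = c & mx2 a b c d 1 1 = d].
Proof. by rewrite !mxE. Qed.

Lemma det_mx2E (a b c d : F) : \det (mx2 a b c d) = a * d - b * c.
Proof. by rewrite det_mx2; have [-> -> -> ->] := mx2E a b c d. Qed.

Lemma quad_kron (A : 'M[F]_2) v : \det A = 1 -> quad (kron q A *m v) = quad v.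
Proof.
move=> dA; have e := congr1 (fun x => x ^+ q) dA; move: dA e; rewrite det_mx2 expr1n frobB !exprMn => dA e.
(* The right-hand side is multiplied by [\det A] and its Frobenius image, both 1, which makes the
   goal a polynomial identity. *)
rewrite -[RHS]mul1r -[X in X * _]mul1r -[X in X * _ * _]e -[X in _ * X * _]dA /quad.
by have [-> -> -> ->] := coord_kron A v; ring.
Qed.

Lemma polar_kron (A : 'M[F]_2) u v : \det A = 1 -> polar (kron q A *m u) (kron q A *m v) = polar u v.
Proof.
move=> dA; have := quadD (kron q A *m u) (kron q A *m v).
rewrite -mulmxDr !quad_kron // quadD => e.
by apply: (addrI (quad u)); apply: (addIr (quad v)).
Qed.

Lemma herm_kron (A : 'M[F]_2) v : \det A = 1 -> herm (kron q A *m v) (kron q A *m v) = herm v v.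
Proof.
move=> dA; have e := congr1 (fun x => x ^+ q) dA; move: dA e; rewrite det_mx2 expr1n frobB !exprMn => dA e.
rewrite -[RHS]mul1r -[X in X * _]mul1r -[X in X * _ * _]e -[X in _ * X * _]dA /herm.
have [-> -> -> ->] := coord_kron A v.
by rewrite !(frobD, exprMn, frobK); ring.
Qed.

Lemma F_eq_kron (A : 'M[F]_2) g v : \det A = 1 -> F_eq q g (kron q A *m v) = F_eq q g v.
Proof. by move=> dA; rewrite !F_eqE quad_kron ?herm_kron. Qed.

Lemma kron_mul (A B : 'M[F]_2) : kron q A *m kron q B = kron q (A *m B).
Proof.
transitivity ((frob_mx q A *m frob_mx q B) *t (A *m B)); first exact: (@tensmx_mul _ 2 2 2 2 2 2).
rewrite /kron; suff -> : frob_mx q A *m frob_mx q B = frob_mx q (A *m B) by [].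
by apply/matrixP=> i j; rewrite !mxE frob_sum; apply: eq_bigr => l _; rewrite !mxE exprMn.
Qed.

Lemma kron_mulv (A B : 'M[F]_2) v : kron q A *m (kron q B *m v) = kron q (A *m B) *m v.
Proof. by rewrite mulmxA kron_mul. Qed.

Lemma kron1 v : kron q 1%:M *m v = v.
Proof.
have [e0 e1 e2 e3] := coord_kron 1%:M v; apply: coord_inj;
  by rewrite (e0, e1, e2, e3) !mxE /= !(expr1n, frob0, mul1r, mul0r, addr0, add0r).
Qed.

Lemma kron_unit (A : 'M[F]_2) : \det A = 1 -> kron q A \in unitmx.
Proof.
move=> dA; have uA : A \in unitmx by rewrite unitmxE dA unitr1.
suff : kron q A *m kron q (invmx A) = 1%:M by case/mulmx1_unit.
rewrite kron_mul mulmxV //; apply/matrixP=> i j.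
transitivity (col j (kron q (1%:M : 'M[F]_2)) i 0); first by rewrite [RHS]mxE.
by rewrite colE kron1 !mxE eqxx andbT.
Qed.

(** * The elliptic quadric O *)

(** Homogeneous parametrization of [OO] by the projective line: as a matrix, the rank one product of
    the column [(a ^+ q, b ^+ q)] and the row [(a, b)]. Hence [kron q A] acts through [A] on
    [(a, b)]. *)
Definition ov (a b : F) : 'cV[F]_4 := vec4 (a ^+ q.+1) (a ^+ q * b) (a * b ^+ q) (b ^+ q.+1).

Lemma kron_ov (A : 'M[F]_2) a b :
  kron q A *m ov a b = ov (A 0 0 * a + A 0 1 * b) (A 1 0 * a + A 1 1 * b).
Proof.
have [e0 e1 e2 e3] := coord_kron A (ov a b); apply: coord_inj;
  by rewrite (e0, e1, e2, e3) !coord_vec4 !exprS !frobD !exprMn; ring.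
Qed.

Lemma quad_ov a b : quad (ov a b) = 0.
Proof. by rewrite /quad !coord_vec4 !exprS; ring. Qed.

(** Consequently two points of [OO] are polar to each other only if they coincide. *)
Lemma polar_ov a b c d : polar (ov a b) (ov c d) = (a * d - b * c) ^+ q.+1.
Proof. by rewrite /polar !coord_vec4 !exprS frobB !exprMn; ring. Qed.

Lemma ovZ c a b : ov (c * a) (c * b) = c ^+ q.+1 *: ov a b.
Proof. by apply: coord_inj; rewrite coordZ !coord_vec4 !exprS !exprMn; ring. Qed.

Lemma ov_eq0 a b : (ov a b == 0) = (a == 0) && (b == 0).
Proof.
rewrite vec4_eq0 !expf_eq0 !mulf_eq0 !expf_eq0 (ltnW (ltnW q_gt2)) /=.
by case: (a == 0); case: (b == 0).
Qed.

Lemma ov_vline a b c d : ov a b != 0 -> ov c d != 0 -> a * d = b * c ->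
  <[ov a b]>%VS = <[ov c d]>%VS.
Proof.
move=> ab0 cd0 e; apply/eqP/vline_eqP => //.
have [t t0 tE] : exists2 t, t != 0 & c = t * a /\ d = t * b.
  move: ab0 cd0; rewrite !ov_eq0 !negb_and; case: (eqVneq a 0) e => [->|a0].
    rewrite mul0r /= => /esym/eqP; rewrite mulf_eq0 => e b0.
    move: e; rewrite (negPf b0) => /= /eqP -> ; rewrite eqxx /= => d0.
    by exists (d / b); rewrite ?mulr0 ?divfK // mulf_neq0 ?invr_neq0.
  move=> e _ cd; have dE : d = c / a * b by apply: (mulfI a0); rewrite e; field.
  exists (c / a); last by rewrite divfK.
  move: cd; rewrite dE !mulf_eq0 !negb_or !invr_eq0 a0 !andbT.
  by case: (c != 0).
by exists (t ^+ q.+1); rewrite ?expf_neq0 // -ovZ; case: tE => -> ->.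
Qed.

Lemma OO_ov P : P \in OO F q -> exists a b, ov a b != 0 /\ P = <[ov a b]>%VS.
Proof.
rewrite inE => /orP[/imsetP[t _ ->]|].
  exists 1, t; rewrite ov_eq0 oner_eq0; split=> //.
  by congr <[vec4 _ _ _ _]>%VS; rewrite ?expr1n ?mul1r.
rewrite inE => /eqP->; exists 0, 1; rewrite ov_eq0 oner_eq0 andbF; split=> //.
by rewrite /ov expr0n /= frob0 !expr1n !mul0r.
Qed.

Lemma mem_OO v : v != 0 -> quad v = 0 -> herm v v = 0 -> <[v]>%VS \in OO F q.
Proof.
rewrite /quad /herm; set x := coord v 0; set y := coord v 1; set z := coord v 2; set t := coord v 3.
move=> v0 Qv hv; rewrite inE; case: (eqVneq x 0) => [x0|x0]; last first.
  apply/orP; left; apply/imsetP; exists (y / x) => //; apply/eqP/vline_eqP => //.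
  have tE : t = y * z / x by apply: (mulfI x0); move/eqP: Qv; rewrite subr_eq0 => /eqP ->; field.
  have xq0 : x ^+ q != 0 by rewrite expf_neq0.
  have zE : z = x * (y / x) ^+ q.
    (* Substituting [t = y * z / x] factors the Hermitian equation into two conjugates up to sign;
       the vanishing of either says [z / x = (y / x) ^+ q]. *)
    have : (y * x ^+ q - x * z ^+ q) * (z * x ^+ q - x * y ^+ q) = 0.
      transitivity (x * x ^+ q * (x ^+ q * t + t ^+ q * x - y ^+ q * y - z ^+ q * z)); last by rewrite hv mulr0.
      by rewrite tE !expr_div_n !exprMn; field; rewrite xq0.
    move/eqP; rewrite mulf_eq0 !subr_eq0 => /orP[] /eqP e.
      have e' : y ^+ q * x = x ^+ q * z by rewrite -[x in LHS]frobK -exprMn e exprMn frobK.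
      by rewrite expr_div_n mulrA (mulrC x) e' mulrAC mulfV ?mul1r.
    by rewrite expr_div_n mulrA -e mulfK.
  exists x^-1; rewrite ?invr_neq0 //; apply: coord_inj; rewrite coordZ !coord_vec4.
  - by rewrite mulVf.
  - by rewrite mulrC.
  - by rewrite -/z zE mulKf.
  by rewrite -/t tE zE exprS; field.
apply/orP; right; rewrite inE.
have hyz : y ^+ q * y + z ^+ q * z = 0.
  by apply: oppr_inj; rewrite oppr0 -hv x0 frob0; ring.
have [y0 z0] : y = 0 /\ z = 0.
  have : y * z = 0 by apply: oppr_inj; rewrite oppr0 -Qv x0; ring.
  move/eqP; rewrite mulf_eq0 => /orP[] /eqP e; move: hyz; rewrite e mulr0 ?(addr0, add0r) -exprSr;
  by move/eqP; rewrite expf_eq0 => /andP[_ /eqP].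
rewrite eq_sym; apply/vline_eqP; first by rewrite vec4_eq0 oner_eq0 !andbF.
exists t; last by apply: coord_inj; rewrite coordZ !coord_vec4 -/x -/y -/z -/t ?x0 ?y0 ?z0 ?mulr0 ?mulr1.
apply: contraNneq v0 => t0; apply/eqP/coord_inj; rewrite coord0 //.
Qed.

(** * Lines contained in a set of type V4 *)

(* After reducing exponents modulo [s ^+ (q ^ 2) = s], the left-hand side has no
   term in [s ^+ (q - 1)], and the right-hand side has [k.+1 * alpha ^+ k * c]. *)
Lemma norm_type_const (alpha c eps : F) : alpha != 0 -> eps != 0 ->
    (forall s, ((alpha * s ^+ 2 + c) ^+ k.+1) ^+ q = eps * (alpha * s ^+ 2 + c) ^+ k.+1) ->
  c = 0.
Proof.
move=> alpha0 eps0 cst.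
pose a i : F := (c ^+ (k.+1 - i) * alpha ^+ i) *+ 'C(k.+1, i).
have expand s : (alpha * s ^+ 2 + c) ^+ k.+1 = \sum_(i < k.+2) a i * s ^+ (2 * i).
  rewrite addrC exprDn; apply: eq_bigr => i _.
  by rewrite exprMn -exprM -mulrnAl /a mulrnAl mulrA -mulrnAl.
(* Only the top term, of exponent [q * (q + 1)], reaches degree [q ^ 2]; as a function of [s] it
   equals [s ^+ q.+1]. *)
pose f : {poly F} := \sum_(i < k.+1) a i ^+ q *: 'X^(2 * i * q) + a k.+1 ^+ q *: 'X^(q.+1)
   - \sum_(i < k.+2) (eps * a i) *: 'X^(2 * i).
have f0 : f = 0.
  apply: poly_vanish => [|s].
    have big (b : F) n : (n < q ^ 2)%N -> (size (b *: 'X^n) <= q ^ 2)%N.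
      by move=> nq; rewrite (leq_trans (size_scale_leq _ _)) // size_polyXn.
    rewrite /f (leq_trans (size_polyD _ _)) // geq_max size_polyN; apply/andP; split.
      rewrite (leq_trans (size_polyD _ _)) // geq_max big; last by rewrite q_def; nia.
      rewrite andbT; apply: (leq_trans (size_sum _ _ _)); apply/bigmax_leqP=> i _; apply: big.
      by rewrite -mulnn ltn_pmul2r; have := ltn_ord i; rewrite q_def; lia.
    apply: (leq_trans (size_sum _ _ _)); apply/bigmax_leqP=> i _; apply: big.
    have := ltn_ord i; rewrite q_def; nia.
  rewrite /f hornerD hornerN hornerD !horner_sum hornerZ hornerXn.
  under eq_bigr do rewrite hornerZ hornerXn exprM.
  under [X in - X]eq_bigr do rewrite hornerZ hornerXn -mulrA.
  rewrite -mulr_sumr -expand -cst expand frob_sum [in X in - X]big_ord_recr /=.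
  have -> : (a k.+1 * s ^+ (2 * k.+1)) ^+ q = a k.+1 ^+ q * s ^+ q.+1.
    rewrite exprMn -exprM (_ : 2 * k.+1 * q = q * q + q)%N; last by rewrite q_def; lia.
    by rewrite exprD exprM frobK -exprS.
  rewrite opprD addrACA subrr addr0 -sumrB big1 // => i _.
  by rewrite exprMn subrr.
have := congr1 (fun p : {poly F} => p`_(2 * k)) f0.
rewrite coef0 /f coefB coefD !coef_sum coefZ coefXn big1 => [|i _]; last first.
  rewrite coefZ coefXn (_ : (_ == _) = false) ?mulr0 //; apply/negP=> /eqP.
  by case: (nat_of_ord i) => [|j]; rewrite q_def; nia.
rewrite add0r (_ : (_ == _) = false) ?mulr0; last by rewrite q_def; lia.
rewrite (bigD1 (inord k)) //= coefZ coefXn inordK // eqxx mulr1 big1 => [|i]; last first.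
  rewrite coefZ coefXn => ik; rewrite (_ : (_ == _) = false) ?mulr0 //; apply/negP=> /eqP e.
  case/eqP: ik; apply: val_inj; rewrite /= inordK //; lia.
rewrite addr0 sub0r => /eqP; rewrite oppr_eq0 mulf_eq0 (negPf eps0) /= /a subSnn expr1 binSn.
rewrite -mulr_natr mulf_eq0 (negPf half_neq0) orbF mulf_eq0 expf_eq0 (negPf alpha0) andbF orbF.
by move/eqP.
Qed.

(** Each equation restricts to a polynomial of degree at most [q + 1]. Their product vanishes on all
    of [F] and has degree below [q ^ 2], so it is the zero polynomial and one factor is zero. *)
Lemma line_in_two_surfaces (g1 g2 : F) r z : polar r z = 0 ->
    (forall s, F_eq q g1 (s *: r + z) = 0 \/ F_eq q g2 (s *: r + z) = 0) ->
  (forall s, F_eq q g1 (s *: r + z) = 0) \/ (forall s, F_eq q g2 (s *: r + z) = 0).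
Proof.
move=> rz cover.
pose N : {poly F} := (quad r *: 'X^2 + (quad z)%:P) ^+ k.+1.
pose h : {poly F} := (herm z z)%:P + herm z r *: 'X + herm r z *: 'X^q + herm r r *: 'X^(q.+1).
pose f g := h - g *: N.
have fE g s : (f g).[s] = F_eq q g (s *: r + z).
  rewrite F_eqE quadD quadZ polarZl rz mulr0 addr0 !(hermDl, hermDr, hermZl, hermZr).
  rewrite /f /h /N !(hornerD, hornerN, hornerZ, horner_exp, hornerXn, hornerX, hornerC).
  by rewrite (exprS s q) (mulrC (quad r)); ring.
have big (b : F) n : (n < q.+2)%N -> (size (b *: 'X^n) <= q.+2)%N.
  by move=> nq; rewrite (leq_trans (size_scale_leq _ _)) // size_polyXn.
have sizef g : (size (f g) <= q.+2)%N.
  rewrite (leq_trans (size_polyD _ _)) // geq_max size_polyN; apply/andP; split.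
    do 2![rewrite (leq_trans (size_polyD _ _)) // geq_max big ?andbT //].
    rewrite (leq_trans (size_polyD _ _)) // geq_max.
    by rewrite -['X]expr1 big // ?andbT (leq_trans (size_polyC_leq1 _)).
  rewrite (leq_trans (size_scale_leq _ _)) // (leq_trans (size_poly_exp_leq _ _)) //.
  have : (size (quad r *: 'X^2 + (quad z)%:P)%R <= 3)%N.
    rewrite (leq_trans (size_polyD _ _)) // geq_max (leq_trans (size_polyC_leq1 _)) // andbT.
    by rewrite (leq_trans (size_scale_leq _ _)) // size_polyXn.
  by rewrite q_def; case: (size _) => [|[|[|[|n]]]] //=; lia.
have : f g1 * f g2 = 0.
  apply: poly_vanish => [|s].
    (* The product has size at most [2 * q + 3], which is exactly [q ^ 2] for [q = 3]. *)
    apply: (leq_trans (size_polyMleq _ _)); have := sizef g1; have := sizef g2.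
    rewrite q_def; nia.
  by rewrite hornerM !fE; case: (cover s) => ->; rewrite ?mul0r ?mulr0.
move/eqP; rewrite mulf_eq0 => /orP[] /eqP f0; [left|right] => s.
  by rewrite -fE f0 horner0.
by rewrite -fE f0 horner0.
Qed.

(** Independent of the representative: scaling [v] by [a] multiplies [quad v ^+ k.+1] by
    [a ^+ q.+1], which Frobenius fixes. *)
Definition norm_type (eps : F) v : Prop := (quad v ^+ k.+1) ^+ q = eps * quad v ^+ k.+1.

(* [g1] and [g2] are the parameters of the two surfaces whose union contains V (0 for a
   subset of the Hermitian surface); the three values of [m'] give three of the lines of V
   through the point (1, 0, 0, 0) of [OO]. *)
Record surface_model (g1 g2 eps1 eps2 m : F) V : Prop := SurfaceModel {
  sm_sub : V \subset PG3 F;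
  sm_cover : forall v, v != 0 -> <[v]>%VS \in V -> F_eq q g1 v = 0 \/ F_eq q g2 v = 0;
  sm_type1 : forall v, v != 0 -> <[v]>%VS \in V -> F_eq q g1 v = 0 -> norm_type eps1 v;
  sm_type2 : forall v, v != 0 -> <[v]>%VS \in V -> F_eq q g2 v = 0 -> norm_type eps2 v;
  sm_eps1 : eps1 != 0;
  sm_eps2 : eps2 != 0;
  sm_g1 : g1 ^+ 2 != 4%:R;
  sm_g2 : g2 ^+ 2 != 4%:R;
  sm_kron : forall (A : 'M[F]_2) v, \det A = 1 -> <[v]>%VS \in V -> <[kron q A *m v]>%VS \in V;
  sm_base : <[vec4 1 0 0 0]>%VS \in V;
  sm_m_neq0 : m != 0;
  sm_m_norm : m ^+ q.+1 != 1;
  sm_lines : forall m' t, m' \in [:: m; m * xi ^+ (2 * (2 * k)); m^-1] ->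
    <[vec4 t 1 m' 0]>%VS \in V }.

Lemma polarZr a v w : polar v (a *: w) = a * polar v w.
Proof. by rewrite polarC polarZl polarC. Qed.

Lemma polarDr u v w : polar w (u + v) = polar w u + polar w v.
Proof. by rewrite polarC polarDl !(polarC w). Qed.

Lemma half_sqr (y : F) : (y ^+ k.+1) ^+ 2 = y ^+ q.+1.
Proof. by rewrite -exprM; congr (_ ^+ _); rewrite q_def; lia. Qed.

(* At least two of three points of [OO] polar to the same point off [OO] coincide:
   after moving the first one to [(1, 0, 0, 0)], two distinct others would give
   [x2 ^+ (q + 1) = x3 ^+ (q + 1)], hence [g ^+ 2 = 4]. *)
Lemma polar_OO_le2 (g a1 b1 a2 b2 a3 b3 : F) r : g ^+ 2 != 4%:R -> F_eq q g r = 0 -> quad r != 0 ->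
    ov a1 b1 != 0 -> ov a2 b2 != 0 -> ov a3 b3 != 0 ->
    polar (ov a1 b1) r = 0 -> polar (ov a2 b2) r = 0 -> polar (ov a3 b3) r = 0 ->
    <[ov a1 b1]>%VS != <[ov a2 b2]>%VS -> <[ov a1 b1]>%VS != <[ov a3 b3]>%VS ->
  <[ov a2 b2]>%VS = <[ov a3 b3]>%VS.
Proof.
move=> g4 Fr Qr o1 o2 o3 p1 p2 p3 n12 n13.
(* The matrix with rows [(c, d)] and [(- b1, a1)] sends [(a1, b1)] to [(1, 0)]; its determinant is
   written as in [det_mx2E]. *)
have [c [d dA]] : exists c d, c * a1 - d * - b1 = 1.
  move: o1; rewrite ov_eq0 negb_and; case: (eqVneq a1 0) => [->|a0] /= b0.
    by exists 0, b1^-1; rewrite mulr0 sub0r mulrN opprK mulVf.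
  by exists a1^-1, 0; rewrite mul0r subr0 mulVf.
pose A := mx2 c d (- b1) a1; have detA : \det A = 1 by rewrite det_mx2E.
have kA a b : kron q A *m ov a b = ov (c * a + d * b) (a1 * b - b1 * a).
  by rewrite kron_ov; have [-> -> -> ->] := mx2E c d (- b1) a1; congr ov; ring.
pose s := kron q A *m r.
have Fs : F_eq q g s = 0 by rewrite F_eq_kron.
have Qs : quad s != 0 by rewrite quad_kron.
have ps a b : polar (ov a b) r = 0 -> polar (ov (c * a + d * b) (a1 * b - b1 * a)) s = 0.
  by move=> e; rewrite -kA polar_kron.
have s3 : coord s 3 = 0.
  move: (ps _ _ p1); rewrite (_ : c * a1 + d * b1 = 1); last by rewrite -dA; ring.
  rewrite (_ : a1 * b1 - b1 * a1 = 0); last by ring.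
  rewrite /polar !coord_vec4 !exprS expr1n !frob0; move=> e; rewrite -[RHS]e; ring.
(* Any other of the points becomes [ov t 1] up to a scalar, and its polarity with [s] is an equation
   in [t] alone. *)
have sol a b : ov a b != 0 -> polar (ov a b) r = 0 -> <[ov a1 b1]>%VS != <[ov a b]>%VS ->
    a1 * b - b1 * a != 0 /\ let t := (c * a + d * b) / (a1 * b - b1 * a) in
      coord s 0 - t ^+ q * coord s 2 - t * coord s 1 = 0.
  move=> o e n; have D0 : a1 * b - b1 * a != 0.
    by apply: contraNneq n => /eqP; rewrite subr_eq0 => /eqP e'; apply/eqP/ov_vline.
  split=> //=; move: (ps _ _ e); set D := a1 * b - b1 * a in D0 *; set E := c * a + d * b.
  have Dq0 : D ^+ q != 0 by rewrite expf_neq0.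
  rewrite /polar !coord_vec4 s3 mulr0 add0r exprS => e'.
  apply: (mulfI D0); apply: (mulfI Dq0); rewrite !mulr0 -[RHS]e' expr_div_n.
  by field; rewrite D0.
have [D2 e2] := sol _ _ o2 p2 n12; have [D3 e3] := sol _ _ o3 p3 n13.
move: e2 e3; rewrite /=; set t2 := (_ / _); set t3 := (_ / _) => e2 e3.
case: (eqVneq t2 t3) => [t23|t23].
  apply: ov_vline => //; have : (c * a2 + d * b2) * (a1 * b3 - b1 * a3) = (c * a3 + d * b3) * (a1 * b2 - b1 * a2).
    by apply/eqP; rewrite -eqr_div //; apply/eqP.
  move=> e; apply/eqP; rewrite -subr_eq0 -[_ - _]mul1r -dA; apply/eqP.
  by transitivity ((c * a2 + d * b2) * (a1 * b3 - b1 * a3) - (c * a3 + d * b3) * (a1 * b2 - b1 * a2));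
    [ring | rewrite e subrr].
(* The difference of the two equations is [w ^+ q * coord s 2 + w * coord s 1 = 0], so coordinates 1
   and 2 of [s] have the same norm. *)
pose w := t2 - t3; have w0 : w != 0 by rewrite subr_eq0.
have ew : w ^+ q * coord s 2 = - (w * coord s 1).
  apply/eqP; rewrite -addr_eq0; apply/eqP; rewrite /w frobB -[RHS](subrr 0) -{1}e3 -e2; ring.
have wq0 : w ^+ q != 0 by rewrite expf_neq0.
have nn : coord s 2 ^+ q.+1 = coord s 1 ^+ q.+1.
  have e := congr1 (fun x => x ^+ q) ew; rewrite frobN !exprMn frobK in e.
  apply: (mulfI w0); apply: (mulfI wq0); rewrite !exprS.
  transitivity ((w ^+ q * coord s 2) * (w * coord s 2 ^+ q)); first by ring.
  by rewrite ew e; ring.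
case/eqP: g4; move: Fs Qs; rewrite F_eqE /herm /quad s3 frob0 !(mulr0, mul0r, addr0, sub0r) -!exprSr nn => Fs Q0.
(* The equation [F_eq q g s = 0] with equal norms; squaring it gives [g ^+ 2 = 4]. *)
have e : - (2%:R * coord s 1 ^+ q.+1) = g * (- (coord s 1 * coord s 2)) ^+ k.+1.
  by apply/eqP; rewrite -subr_eq0 -[X in _ == X]Fs; apply/eqP; ring.
have := congr1 (fun x => x ^+ 2) e; rewrite [in RHS]exprMn half_sqr.
have -> : (- (coord s 1 * coord s 2)) ^+ q.+1 = (coord s 1 ^+ q.+1) ^+ 2.
  by rewrite exprS frobN mulrNN -exprS exprMn nn expr2.
move=> e'; apply: (mulIf (_ : (coord s 1 ^+ q.+1) ^+ 2 != 0)).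
  by move: Q0; rewrite oppr_eq0 mulf_eq0 negb_or => /andP[x0 _]; rewrite !expf_neq0.
by rewrite -e'; ring.
Qed.

(** * The four properties of the pair (V, O) *)

Section Model.
Variables (g1 g2 eps1 eps2 m : F) (V : {set space}).
Hypothesis modelV : surface_model g1 g2 eps1 eps2 m V.

(** Take [z] on [l] polar to [r]. The points [s *: r + z] all lie on one of the two surfaces, so
    they share a norm type, while [quad] there is [quad r * s ^+ 2 + quad z]; [norm_type_const] then
    gives [quad z = 0]. *)
Lemma sm_perp l r : line_in V l -> r \in l -> quad r != 0 ->
  exists2 z, z \in l & [/\ z != 0, quad z = 0 & polar r z = 0].
Proof.
case: modelV => _ cover type1 type2 e1 e2 _ _ _ _ _ _ _.
move=> /line_inP[dl lV] rl Qr; have r0 : r != 0.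
  by apply: contraNneq Qr => ->; rewrite /quad !coord0 !mul0r subrr.
have [w wl wr] := line_spanning dl rl r0.
pose c := polar r w / (2%:R * quad r); pose z := w - c *: r.
have zl : z \in l by rewrite memvB // memvZ.
have zr : z \notin <[r]>%VS.
  by apply: contra wr => zr; rewrite -[w](subrK (c *: r)) memvD // memvZ // memv_line.
have rz : polar r z = 0.
  rewrite /z -scaleNr polarDr polarZr polar_quad /c; field.
  by rewrite Qr two_neq0.
have inV s : s *: r + z != 0 /\ <[s *: r + z]>%VS \in V.
  have nz : s *: r + z != 0.
    by apply: contraNneq zr => /eqP; rewrite addrC addr_eq0 => /eqP->; rewrite memvN memvZ // memv_line.
  by split=> //; apply: lV => //; rewrite memvD // memvZ.
have Q s : quad (s *: r + z) = quad r * s ^+ 2 + quad z.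
  by rewrite quadD quadZ polarZl rz mulr0 addr0 mulrC.
exists z => //; split=> //; first by apply: contraNneq zr => ->; rewrite mem0v.
have [s|F1|F2] := line_in_two_surfaces (g1 := g1) (g2 := g2) rz.
- by have [nz] := inV s; exact: cover.
- apply: (norm_type_const Qr e1) => s; rewrite -Q; have [nz sV] := inV s.
  exact: type1.
- apply: (norm_type_const Qr e2) => s; rewrite -Q; have [nz sV] := inV s.
  exact: type2.
Qed.

Lemma sm_OO v : v != 0 -> <[v]>%VS \in V -> quad v = 0 -> <[v]>%VS \in OO F q.
Proof.
move=> v0 vV Qv; apply: mem_OO => //.
by case: (sm_cover modelV v0 vV); rewrite F_eqE Qv expr0n /= mulr0 subr0.
Qed.

Lemma quad_off_OO v : v != 0 -> <[v]>%VS \in V -> <[v]>%VS \notin OO F q -> quad v != 0.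
Proof. by move=> v0 vV; apply: contraNneq; exact: sm_OO. Qed.

(** The points with parameters (1, 0), (0, 1), (1, 1) and [(1, xi)] suffice: a plane through the
    first three has equation [c 1 * (X_2 - X_3) = 0], and it misses the last because
    [xi ^+ q != xi]. *)
Lemma model_span (u : 'rV[F]_4) : u != 0 ->
  exists v, [/\ v != 0, <[v]>%VS \in OO F q & u *m v != 0].
Proof.
move=> u0; pose c i := u 0 (inord i).
have uE a b : u *m ov a b = (c 0%N * a ^+ q.+1 + c 1%N * (a ^+ q * b) + c 2 * (a * b ^+ q) + c 3 * b ^+ q.+1)%:M.
  apply/matrixP=> i j; rewrite !ord1 !mxE eqxx mulr1n sum_ord4.
  have vE t : ov a b (inord t) 0 = coord (ov a b) t by [].
  by rewrite !vE !coord_vec4.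
have inO a b : ov a b != 0 -> <[ov a b]>%VS \in OO F q.
  move=> ab0; apply: mem_OO => //; first exact: quad_ov.
  by rewrite /herm !coord_vec4 !exprS !exprMn !frobK; ring.
suff [a [b [ab0 uab]]] : exists a b, ov a b != 0 /\
    c 0%N * a ^+ q.+1 + c 1%N * (a ^+ q * b) + c 2 * (a * b ^+ q) + c 3 * b ^+ q.+1 != 0.
  exists (ov a b); split=> //; first exact: inO.
  by rewrite uE; apply: contraNneq uab => /matrixP/(_ 0 0)/eqP; rewrite !mxE eqxx mulr1n.
have ov1 b : ov 1 b != 0 by rewrite ov_eq0 oner_eq0.
have ov01 : ov 0 1 != 0 by rewrite ov_eq0 oner_eq0 andbF.
case: (eqVneq (c 0%N) 0) => [c0|c0]; last first.
  exists 1, 0; split=> //; by rewrite !(expr1n, exprS, frob0, mulr0, mul0r, mulr1, addr0).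
case: (eqVneq (c 3) 0) => [c3|c3]; last first.
  exists 0, 1; split=> //; by rewrite !(expr1n, exprS, frob0, mulr0, mul0r, mulr1, add0r).
case: (eqVneq (c 1%N + c 2) 0) => [c12|c12]; last first.
  by exists 1, 1; split=> //; rewrite c0 c3 !(expr1n, mul0r, mulr1, add0r, addr0).
have c1 : c 1%N != 0.
  apply: contraNneq u0 => c1; move/eqP: c12; rewrite c1 add0r => /eqP c2.
  apply/eqP/matrixP=> i j; rewrite [i]ord1 [RHS]mxE -[j]inord_val.
  by case: j => [[|[|[|[|j]]]] ltj].
exists 1, xi; split=> //.
rewrite c0 c3 !(expr1n, mul0r, add0r, addr0, mul1r).
have -> : c 2 = - c 1%N by apply/eqP; rewrite -addr_eq0 addrC c12.
by rewrite mulNr -mulrBr mulf_neq0 // subr_eq0 eq_sym xi_frob.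
Qed.

(** Each line of [V] through [P] joins it to a point of [OO] polar to it, and [polar_OO_le2] allows
    only two such points. *)
Lemma model_few P (ls : seq space) : P \in V -> P \notin OO F q -> uniq ls ->
  all (fun l => line_in V l && (P <= l)%VS) ls -> (size ls <= 2)%N.
Proof.
move=> PV PO; have /pointP[r r0 PE] := subsetP (sm_sub modelV) P PV.
rewrite {P}PE in PV PO *; have Qr := quad_off_OO r0 PV PO.
case: ls => [|l1 [|l2 [|l3 ls]]] //= /andP[]; rewrite !inE !negb_or.
move=> /and3P[n12 n13 _] /and3P[/andP[n23 _] _ _].
have ovl l : line_in V l && (<[r]> <= l)%VS -> exists a b,
    [/\ ov a b != 0, polar (ov a b) r = 0 & l = (<[r]> + <[ov a b]>)%VS].
  case/andP=> lV; rewrite -memvE => rl; have [dl lV'] := line_inP _ _ lV.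
  have [z zl [z0 Qz rz]] := sm_perp lV rl Qr.
  have [a [b [ab0 zE]]] := OO_ov (sm_OO z0 (lV' z zl z0) Qz).
  have [c c0 ovE] : exists2 c, c != 0 & ov a b = c *: z by apply/vline_eqP; rewrite // zE.
  exists a, b; split=> //; first by rewrite ovE polarZl polarC rz mulr0.
  apply: join_eq => //; first by rewrite ovE memvZ.
  apply: contraNN Qr => /vlineP[d ovr]; have : quad (ov a b) = 0 by rewrite quad_ov.
  have d0 : d != 0 by apply: contraNneq ab0 => d0; rewrite ovr d0 scale0r.
  by rewrite ovr quadZ => /eqP; rewrite mulf_eq0 expf_eq0 (negPf d0).
case/and4P=> /ovl[a1 [b1 [o1 p1 l1E]]] /ovl[a2 [b2 [o2 p2 l2E]]] /ovl[a3 [b3 [o3 p3 l3E]]] _.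
have [g g4 Fr] : exists2 g, g ^+ 2 != 4%:R & F_eq q g r = 0.
  by case: (sm_cover modelV r0 PV) => ?; [exists g1|exists g2] => //;
    [apply: (sm_g1 modelV)|apply: (sm_g2 modelV)].
case/eqP: n23; rewrite l2E l3E (polar_OO_le2 g4 Fr Qr o1 o2 o3 p1 p2 p3) //.
- by apply: contra_neq n12 => e; rewrite l1E l2E e.
- by apply: contra_neq n13 => e; rewrite l1E l3E e.
Qed.

(** For distinct points [o], [o'] of [OO] on [l], [sm_perp] at [o + o'] yields a nonzero
    [x *: o + y *: o'] with [x * y = 0] and [x + y = 0], which is absurd. *)
Lemma model_cap l P Q : line_in V l -> P \in OO F q -> Q \in OO F q ->
  (P <= l)%VS -> (Q <= l)%VS -> P = Q.
Proof.
move=> lV /OO_ov[a [b [ab0 ->]]] /OO_ov[c [d [cd0 ->]]]; rewrite -!memvE => ol o'l.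
apply/eqP; apply: contraT => ne.
have B0 : polar (ov a b) (ov c d) != 0.
  rewrite polar_ov expf_neq0 // subr_eq0; apply: contraNneq ne => e; apply/eqP.
  exact: ov_vline.
pose r := ov a b + ov c d.
have rl : r \in l by rewrite memvD.
have Qr : quad r = polar (ov a b) (ov c d) by rewrite quadD !quad_ov addr0 add0r.
have [|z zl [z0 Qz rz]] := sm_perp lV rl; first by rewrite Qr.
have [dl _] := line_inP _ _ lV.
have cd_ab : ov c d \notin <[ov a b]>%VS.
  apply: contra ne => /vlineP[t tE]; apply/vline_eqP => //; exists t => //.
  by apply: contraNneq cd0 => t0; rewrite tE t0 scale0r.
have : z \in (<[ov a b]> + <[ov c d]>)%VS by rewrite -(join_eq dl ol o'l).
case/mem_join=> x [y zE]; case/eqP: z0.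
have /eqP xy : x * y = 0.
  apply: (mulIf B0); rewrite mul0r -Qz zE quadD !quadZ !quad_ov polarZl polarZr; ring.
have /eqP : x + y = 0.
  apply: (mulIf B0); rewrite mul0r -rz zE /r polarDl !polarDr !polarZr.
  by rewrite !polar_quad !quad_ov (polarC (ov c d)); ring.
rewrite addr_eq0 => /eqP xE; move: xy; rewrite xE mulNr oppr_eq0 mulf_eq0 orbb => /eqP y0.
by rewrite zE xE y0 oppr0 !scale0r addr0.
Qed.

Lemma proj_map_vline (M : 'M[F]_4) v : proj_map M <[v]>%VS = <[M *m v]>%VS.
Proof. by rewrite /proj_map limg_line lfunE. Qed.

(** K moves (1, 0, 0, 0) to any point of [OO], so it is enough to join (1, 0, 0, 0) to
    [(0, 1, m', 0)] for the three values [m'] of the model. *)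
Lemma model_many P : P \in OO F q -> exists ls : seq space,
  [/\ uniq ls, size ls = 3%N & all (fun l => line_in V l && (P <= l)%VS) ls].
Proof.
case/OO_ov=> a [b [ab0 ->]].
have [c [d cd]] : exists c d, a * d - c * b = 1.
  move: ab0; rewrite ov_eq0 negb_and; case: (eqVneq a 0) => [->|a0] /= b0.
    by exists (- b^-1), 0; rewrite mulr0 sub0r mulNr opprK mulVf.
  by exists 0, a^-1; rewrite mul0r subr0 mulfV.
pose A := mx2 a c b d; have detA : \det A = 1 by rewrite det_mx2E.
have kA : kron q A *m ov 1 0 = ov a b.
  by rewrite kron_ov; have [-> -> -> ->] := mx2E a c b d; congr ov; ring.
have e0E : ov 1 0 = vec4 1 0 0 0 by rewrite /ov !(expr1n, exprS, frob0, mulr0, mul0r).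
have e00 : vec4 1 0 0 0 != 0 :> 'cV[F]_4 by rewrite vec4_eq0 oner_eq0.
pose ln t : space := (<[vec4 1 0 0 0]> + <[vec4 0 1 t 0]>)%VS.
have ln_dim (t : F) : vec4 0 1 t 0 \notin <[vec4 1 0 0 0]>%VS.
  apply/negP=> /vlineP[s e]; have /eqP := congr1 (fun v : 'cV[F]_4 => coord v 1) e.
  by rewrite coordZ !coord_vec4 mulr0 oner_eq0.
have ln_inj t t' : ln t = ln t' -> t = t'.
  move=> e; have : vec4 0 1 t 0 \in ln t' by rewrite -e memvE addvSr.
  case/mem_join=> x [y E]; have := congr1 (fun v : 'cV[F]_4 => coord v 1) E.
  rewrite coordD !coordZ !coord_vec4 mulr0 mulr1 add0r => y1.
  by have := congr1 (fun v : 'cV[F]_4 => coord v 2) E; rewrite coordD !coordZ !coord_vec4 -y1 mulr0 add0r mul1r.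
pose ms := [:: m; m * xi ^+ (2 * (2 * k)); m^-1].
have lnV t : t \in ms -> line_in V (ln t).
  move=> tms; apply/line_inP; split; first exact: dim_join.
  move=> v /mem_join[x [y ->]] v0; case: (eqVneq y 0) v0 => [->|y0 _].
    rewrite scale0r addr0 scaler_eq0 negb_or => /andP[x0 _].
    suff -> : <[x *: vec4 1 0 0 0]>%VS = <[vec4 1 0 0 0]>%VS :> space by apply: (sm_base modelV).
    by apply/esym/eqP/vline_eqP => //; exists x.
  suff -> : <[x *: vec4 1 0 0 0 + y *: vec4 0 1 t 0]>%VS = <[vec4 (x / y) 1 t 0]>%VS :> space.
    exact: (sm_lines modelV).
  apply/esym/eqP/vline_eqP; first by rewrite vec4_eq0 oner_eq0 andbF.
  exists y => //; apply: coord_inj; rewrite coordD !coordZ !coord_vec4 !(mulr0, mulr1, addr0, add0r) //.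
  by rewrite mulrC divfK.
have VK : proj_map (kron q A) @: V \subset V.
  apply/subsetP=> _ /imsetP[Q QV ->]; have /pointP[v _ QE] := subsetP (sm_sub modelV) Q QV.
  by rewrite QE proj_map_vline (sm_kron modelV) // -QE.
exists (map (fun t => proj_map (kron q A) (ln t)) ms); split=> //.
  have [m0 mn] := (sm_m_neq0 modelV, sm_m_norm modelV).
  have zn : (xi ^+ (2 * k)) ^+ q.+1 = 1.
    by apply/eqP; rewrite -exprM xi_expr_eq1 q_def; apply/dvdnP; exists 1%N; lia.
  rewrite map_inj_uniq => [|t t' /(can_inj (proj_mapK (mulVmx (kron_unit detA))))/ln_inj//].
  rewrite /= !inE negb_or andbT; apply/andP; split; first apply/andP; first split.
  (* The three values are distinct: [xi ^+ (4 * k)] is not 1, and an equality with [m^-1] would give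
     [m ^+ q.+1 = 1], since [xi ^+ (2 * k)] has norm 1. *)
  - rewrite -subr_eq0 -[X in X - _]mulr1 -mulrBr mulf_eq0 (negPf m0) /= subr_eq0 eq_sym xi_expr_eq1.
    by apply/negP=> /dvdn_leq; nia.
  - apply: contraNneq mn => e; have : m ^+ 2 = 1 by rewrite expr2 {2}e mulfV.
    by rewrite (_ : q.+1 = 2 * k.+1)%N ?q_def; [rewrite exprM => ->; rewrite expr1n|lia].
  - apply: contraNneq mn => e; have : (m * xi ^+ (2 * k)) ^+ 2 = 1.
      by rewrite exprMn -exprM (mulnC _ 2%N) expr2 -mulrA e mulfV.
    move=> e2; apply/eqP; rewrite -[LHS]mulr1 -[X in _ * X]zn -exprMn.
    by rewrite (_ : q.+1 = 2 * k.+1)%N ?q_def; [rewrite (exprM (m * _)) e2 expr1n|lia].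
apply/allP=> _ /mapP[t tms ->]; apply/andP; split.
  have := line_in_proj_map (kron_unit detA) (lnV t tms).
  by rewrite /line_in => /andP[-> /= /subset_trans]; apply.
by rewrite -kA -proj_map_vline e0E proj_mapS // addvSl.
Qed.

Lemma model_configuration : configuration V (OO F q).
Proof.
by split; [exact: model_span|exact: model_many|exact: model_few|exact: model_cap].
Qed.

End Model.
(** * Sets of type V4 *)

Lemma dvdn_pmul2l_false d n j : (0 < d)%N -> (0 < j)%N -> (j < n)%N -> (d * n %| d * j)%N = false.
Proof.
by move=> d0 j0 jn; rewrite dvdn_pmul2l //; apply/negP=> /(dvdn_leq j0); rewrite leqNgt jn.
Qed.

Lemma add_inv_sqr_neq4 (u : F) : u != 0 -> u ^+ 2 != 1 -> (u + u^-1) ^+ 2 != 4%:R.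
Proof.
move=> u0 u1; rewrite -subr_eq0 (_ : _ - _ = ((u ^+ 2 - 1) / u) ^+ 2); last by field.
by rewrite expf_neq0 // mulf_neq0 ?invr_neq0 // subr_eq0.
Qed.

Lemma add_inv_neq0 (u : F) : u != 0 -> u ^+ 4 != 1 -> u + u^-1 != 0.
Proof.
move=> u0; apply: contraNneq => e; have : u ^+ 2 = -1.
  apply/eqP; rewrite -addr_eq0 (_ : _ + 1 = u * (u + u^-1)); last by field.
  by rewrite e mulr0.
by rewrite (exprM u 2 2) => ->; rewrite sqrrN expr1n.
Qed.

(** On the surface [g * quad v ^+ k.+1] equals [herm v v], which Frobenius fixes. *)
Lemma norm_type_F_eq (g : F) v : g != 0 -> F_eq q g v = 0 -> norm_type (g / g ^+ q) v.
Proof.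
move=> g0; rewrite F_eqE => /eqP; rewrite subr_eq0 => /eqP e.
have := herm_frob v; rewrite e exprMn /norm_type => e'.
have gq0 : g ^+ q != 0 by rewrite expf_neq0.
by apply: (mulfI gq0); rewrite e'; field.
Qed.

Lemma norm_type_ratio_neq0 (g : F) : g != 0 -> g / g ^+ q != 0.
Proof. by move=> g0; rewrite mulf_neq0 ?invr_eq0 ?expf_neq0. Qed.

(** The parameters gamma of [S_set] and [E_set]. The index of [E_set] is called [i] because [k] is
    [(q - 1) / 2]. *)
Definition gS (j : nat) : F := xi ^+ (j * k) + xi ^- (j * k).
Definition gE (i : nat) : F := xi ^+ (i * k.+1) + xi ^- (i * k.+1).

Lemma S_setE j : S_set q xi j = zeros (F_eq q (gS j)).
Proof. by rewrite /S_set /gS (_ : q.-1 %/ 2 = k)%N // q_def; lia. Qed.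

Lemma E_setE i : E_set q xi i = zeros (F_eq q (gE i)).
Proof. by rewrite /E_set /gE (_ : q.+1 %/ 2 = k.+1)%N // q_def; lia. Qed.

Lemma j_rangeE j : j_range q j -> [/\ (0 < j)%N, (j < 2 * k.+1)%N & j != k.+1].
Proof.
by rewrite /j_range q_def => /andP[/andP[? ?]]; rewrite (_ : (_ %/ 2 = k.+1)%N) => [?|]; [split; lia|lia].
Qed.

Lemma k_rangeE i : k_range q i -> [/\ (0 < i)%N, (i < 2 * k)%N & i != k].
Proof.
by rewrite /k_range q_def => /andP[/andP[? ?]]; rewrite (_ : (_ %/ 2 = k)%N) => [?|]; [split; lia|lia].
Qed.

Lemma xi_expr_neq0 n : xi ^+ n != 0. Proof. by rewrite expf_neq0 ?xi_neq0. Qed.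

Lemma gS_sqr j : j_range q j -> gS j ^+ 2 != 4%:R.
Proof.
move=> /j_rangeE[j0 jq jk]; apply: add_inv_sqr_neq4; rewrite ?xi_expr_neq0 //.
rewrite -exprM xi_expr_eq1 (_ : 2 * (2 * (k * k.+1)) = 2 * k * (2 * k.+1))%N; last by lia.
by rewrite (_ : j * k * 2 = 2 * k * j)%N ?dvdn_pmul2l_false //; lia.
Qed.

(** A zero would give [xi ^+ (4 * j * k) = 1], that is [k.+1 %| j], and the only such value between
    1 and [q] is the excluded one. *)
Lemma gS_neq0 j : j_range q j -> gS j != 0.
Proof.
move=> /j_rangeE[j0 jq jk]; apply: add_inv_neq0; rewrite ?xi_expr_neq0 //.
rewrite -exprM xi_expr_eq1 (_ : 2 * (2 * (k * k.+1)) = 4 * k * k.+1)%N; last by lia.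
rewrite (_ : j * k * 4 = 4 * k * j)%N; last by lia.
rewrite dvdn_pmul2l; last by lia.
apply/negP=> /dvdnP[c jE]; move: j0 jq jk; rewrite jE; case: c {jE} => [|[|c]]; rewrite ?mul0n ?mul1n ?eqxx //; nia.
Qed.

Lemma gE_sqr i : k_range q i -> gE i ^+ 2 != 4%:R.
Proof.
move=> /k_rangeE[j0 jq jk]; apply: add_inv_sqr_neq4; rewrite ?xi_expr_neq0 //.
rewrite -exprM xi_expr_eq1 (_ : 2 * (2 * (k * k.+1)) = 2 * k.+1 * (2 * k))%N; last by lia.
by rewrite (_ : i * k.+1 * 2 = 2 * k.+1 * i)%N ?dvdn_pmul2l_false //; lia.
Qed.

Lemma gE_neq0 i : k_range q i -> gE i != 0.
Proof.
move=> /k_rangeE[j0 jq jk]; apply: add_inv_neq0; rewrite ?xi_expr_neq0 //.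
rewrite -exprM xi_expr_eq1 (_ : 2 * (2 * (k * k.+1)) = 4 * k.+1 * k)%N; last by lia.
rewrite (_ : i * k.+1 * 4 = 4 * k.+1 * i)%N; last by lia.
rewrite dvdn_pmul2l; last by lia.
apply/negP=> /dvdnP[c jE]; move: j0 jq jk; rewrite jE; case: c {jE} => [|[|c]]; rewrite ?mul0n ?mul1n ?eqxx //; nia.
Qed.

Lemma vec4_line_neq0 (t s : F) : vec4 t 1 s 0 != 0 :> 'cV[F]_4.
Proof. by rewrite vec4_eq0 oner_eq0 /= andbF. Qed.

(** At [(t, 1, m', 0)], put [X = (- m') ^+ k.+1]: the equation is [X ^+ 2 + gE i * X + 1 = 0],
    whatever [t], with roots [- w] and [- w^-1]. The choice of [m] realizes [X = - w]; the factor
    [xi ^+ (4 * k)] leaves [X] unchanged, and inverting [m] inverts [X]. *)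
Lemma E_set_lines i (m := - xi ^+ (2 * k + i)) : k_range q i ->
  [/\ m != 0, m ^+ q.+1 != 1 & forall m' t, m' \in [:: m; m * xi ^+ (2 * (2 * k)); m^-1] ->
      <[vec4 t 1 m' 0]>%VS \in E_set q xi i].
Proof.
move=> ri; have [j0 jq jk] := k_rangeE ri; set w := xi ^+ (i * k.+1).
have w0 : w != 0 := xi_expr_neq0 _.
have m0 : m != 0 by rewrite oppr_eq0 xi_expr_neq0.
have mE : (- m) ^+ k.+1 = - w.
  rewrite opprK -exprM mulnDl exprD -/w (_ : 2 * k * k.+1 = 2 * (k * k.+1))%N; last by lia.
  by rewrite xi_half mulN1r.
clearbody m; have sqE (s : F) : s ^+ q.+1 = ((- s) ^+ k.+1) ^+ 2.
  by rewrite half_sqr !exprS frobN mulrNN.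
split=> //.
  rewrite sqE mE sqrrN -exprM xi_expr_eq1 (_ : 2 * (2 * (k * k.+1)) = 2 * k.+1 * (2 * k))%N; last by lia.
  by rewrite (_ : i * k.+1 * 2 = 2 * k.+1 * i)%N ?dvdn_pmul2l_false //; lia.
move=> m' t m'ms; have m'E : (- m') ^+ k.+1 = - w \/ (- m') ^+ k.+1 = - w^-1.
  move: m'ms; rewrite !inE => /or3P[] /eqP->; [by left|left|right].
    rewrite -mulNr exprMn mE -exprM (_ : 2 * (2 * k) * k.+1 = (2 * (k * k.+1)) * 2)%N; last by lia.
    by rewrite exprM xi_half sqrrN expr1n mulr1.
  have -> : - m^-1 = (- m)^-1 by rewrite invrN.
  by rewrite exprVn mE invrN.
rewrite E_setE mem_zeros_F_eq vec4_line_neq0 F_eqE /herm /quad !coord_vec4 frob0 !(mulr0, mul0r) expr1n.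
rewrite mulr1 add0r !sub0r mul1r -exprSr sqE /gE -/w; apply/eqP.
by case: m'E => ->; field.
Qed.

(** * Invariance under K, and the orbits of K on the Hermitian surface *)

Lemma kron_neq0 (A : 'M[F]_2) v : \det A = 1 -> v != 0 -> kron q A *m v != 0.
Proof.
move=> dA; apply: contraNneq => e.
by rewrite -(mulKmx (kron_unit dA) v) e mulmx0.
Qed.

Lemma zeros_kron g (A : 'M[F]_2) v : \det A = 1 -> <[v]>%VS \in zeros (F_eq q g) ->
  <[kron q A *m v]>%VS \in zeros (F_eq q g).
Proof.
by move=> dA; rewrite !mem_zeros_F_eq F_eq_kron // => /andP[v0 ->]; rewrite kron_neq0.
Qed.

Lemma zeros_sub (f : 'cV[F]_4 -> F) : zeros f \subset PG3 F.
Proof. by apply/subsetP=> P; rewrite inE => /andP[]. Qed.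

Lemma zeros_base (g : F) : <[vec4 1 0 0 0]>%VS \in zeros (F_eq q g).
Proof.
rewrite mem_zeros_F_eq vec4_eq0 oner_eq0 F_eqE /herm /quad !coord_vec4 frob0.
by rewrite !(mulr0, mul0r, subrr, addr0, exprS, oppr0) eqxx.
Qed.

Lemma K_orbit_kron P (A : 'M[F]_2) v : \det A = 1 -> <[v]>%VS \in K_orbit q P ->
  <[kron q A *m v]>%VS \in K_orbit q P.
Proof.
move=> dA /imsetP[B]; rewrite inE => /eqP dB vE.
apply/imsetP; exists (A *m B); first by rewrite inE det_mulmx dA dB mulr1.
rewrite -proj_map_vline vE /proj_map -limg_comp; congr (_ @: _)%VS.
by apply/lfunP=> u; rewrite comp_lfunE !lfunE /= kron_mulv.
Qed.

Lemma K_orbit_refl P : P \in K_orbit q P.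
Proof.
apply/imsetP; exists 1%:M; first by rewrite inE det1.
rewrite /proj_map (_ : linfun _ = \1%VF) ?lim1g //.
by apply/lfunP=> u; rewrite !lfunE /= kron1.
Qed.

Lemma HS_F_eq0 : HS F q = zeros (F_eq q 0).
Proof.
apply/setP=> P; rewrite !inE; congr (_ && _); apply: eq_forallb => v.
by rewrite /F_eq mul0r subr0.
Qed.

Lemma HS_off_OO P : P \in HS F q :\: OO F q ->
  exists r, [/\ r != 0, P = <[r]>%VS, herm r r = 0 & quad r != 0].
Proof.
rewrite in_setD HS_F_eq0 => /andP[PO PH].
have /pointP[r r0 PE] := subsetP (zeros_sub _) P PH.
move: PO PH; rewrite PE mem_zeros_F_eq r0 F_eqE mul0r subr0 => rO /= /eqP hr.
by exists r; split=> //; apply: contraNneq rO => Qr; exact: mem_OO.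
Qed.

(* The norm type is constant on a K-orbit since K preserves [quad]. *)
Lemma K_orbit_type r : r != 0 -> herm r r = 0 -> quad r != 0 ->
  exists2 eps, eps != 0 & forall v, v != 0 -> <[v]>%VS \in K_orbit q <[r]>%VS ->
    F_eq q 0 v = 0 /\ norm_type eps v.
Proof.
move=> r0 hr Qr; have N0 : quad r ^+ k.+1 != 0 by rewrite expf_neq0.
exists ((quad r ^+ k.+1) ^+ q / quad r ^+ k.+1).
  by rewrite mulf_neq0 ?invr_eq0 // expf_neq0.
move=> v v0 /imsetP[A]; rewrite inE => /eqP dA; rewrite proj_map_vline => /eqP.
rewrite eq_sym => /vline_eqP[]; first exact: kron_neq0.
move=> c c0 ->; rewrite F_eqZ F_eq_kron // F_eqE hr mul0r subr0 mulr0; split=> //.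
rewrite /norm_type quadZ quad_kron // exprMn (exprAC c 2) half_sqr.
by rewrite exprMn exprS exprMn frobK; field.
Qed.

Lemma K_orbit_sub P : P \in PG3 F -> K_orbit q P \subset PG3 F.
Proof.
move=> PP; apply/subsetP=> _ /imsetP[A dA ->]; move: dA; rewrite inE => /eqP dA.
by rewrite inE dim_proj_map ?kron_unit //; move: PP; rewrite inE.
Qed.

(* Writing [v] as a 2x2 matrix X, the isotropic condition says that X^-1 X^(q T) has
   trace 0, so its eigenvalues are [+-lam] with [lam ^+ 2 = - quad v ^+ (q - 1)]; an
   eigenbasis provides the rows of [A]. *)
Lemma K_normal_form r : herm r r = 0 -> quad r != 0 ->
  exists2 A : 'M[F]_2, \det A = 1 &
    (coord (kron q A *m r) 1 = 0 /\ coord (kron q A *m r) 2 = 0) \/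
    (coord (kron q A *m r) 0 = 0 /\ coord (kron q A *m r) 3 = 0).
Proof.
move=> hr Qr; set x := coord r 0; set y := coord r 1; set z := coord r 2; set t := coord r 3.
(* The first factor is a square root of -1. *)
pose lam := xi ^+ (k * k.+1) * quad r ^+ k.
have lam2 : lam ^+ 2 * quad r = - quad r ^+ q.
  rewrite exprMn -exprM mulnC xi_half mulN1r -exprM mulNr -exprSr; congr (- (_ ^+ _)).
  by rewrite q_def; lia.
have lam0 : lam != 0 by rewrite mulf_neq0 ?expf_neq0 ?xi_neq0.
clearbody lam; have eigen mu : mu ^+ 2 = lam ^+ 2 -> exists a b, [/\ (a != 0) || (b != 0),
     x ^+ q * a + z ^+ q * b = mu * (x * a + y * b) & y ^+ q * a + t ^+ q * b = mu * (z * a + t * b)].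
  move=> mu2; pose B := mx2 (x ^+ q - mu * x) (y ^+ q - mu * z) (z ^+ q - mu * y) (t ^+ q - mu * t).
  have [B00 B01 B10 B11] : [/\ B 0 0 = x ^+ q - mu * x, B 0 1 = y ^+ q - mu * z,
      B 1 0 = z ^+ q - mu * y & B 1 1 = t ^+ q - mu * t] := mx2E _ _ _ _.
  clearbody B; have : \det B = 0.
    rewrite det_mx2 B00 B01 B10 B11; transitivity (quad r ^+ q + mu ^+ 2 * quad r - mu * herm r r).
      by rewrite /quad /herm frobB !exprMn -/x -/y -/z -/t; ring.
    by rewrite mu2 lam2 hr mulr0 subrr subr0.
  move/eqP/det0P=> [v v0 vB]; exists (v 0 0), (v 0 1).
  have sum2 j : v 0 0 * B 0 j + v 0 1 * B 1 j = 0.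
    have := congr1 (fun w : 'rV[F]_2 => w 0 j) vB.
    rewrite !mxE big_ord_recl big_ord1 => <-.
    by congr (_ + v _ _ * B _ _); apply: val_inj.
  split.
  - apply: contraNT v0; rewrite negb_or !negbK => /andP[/eqP v00 /eqP v01].
    apply/eqP/matrixP=> i j; rewrite [i]ord1 [RHS]mxE.
    by case: j => [[|[|j]]] ltj //; [rewrite -v00|rewrite -v01]; congr (v _ _); apply: val_inj.
  - by have := sum2 0; rewrite B00 B10 => e; apply/eqP; rewrite -subr_eq0 -[X in _ == X]e; apply/eqP; ring.
  - by have := sum2 1; rewrite B01 B11 => e; apply/eqP; rewrite -subr_eq0 -[X in _ == X]e; apply/eqP; ring.
have [a [b [ab0 ab1 ab2]]] := eigen lam erefl.
have [c' [d' [cd0 cd1 cd2]]] : exists a b, [/\ (a != 0) || (b != 0),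
     x ^+ q * a + z ^+ q * b = - lam * (x * a + y * b) & y ^+ q * a + t ^+ q * b = - lam * (z * a + t * b)].
  by apply: eigen; rewrite sqrrN.
pose D := a * d' - b * c'.
(* Proportional eigenvectors for [lam] and [- lam] would be killed by X, against [quad r != 0]. *)
have D0 : D != 0.
  apply/negP=> /eqP De.
  have [s [cE dE]] : exists s, c' = s * a /\ d' = s * b.
    case/orP: ab0 => n0.
      exists (c' / a); rewrite divfK //; split=> //; apply: (mulfI n0).
      by move/eqP: De; rewrite subr_eq0 => /eqP ->; field.
    exists (d' / b); rewrite divfK //; split=> //; apply: (mulfI n0).
    by move/eqP: De; rewrite subr_eq0 => /eqP <-; field.
  have s0 : s != 0.
    by move: cd0; rewrite cE dE; case: (eqVneq s 0) => [->|//]; rewrite !mul0r eqxx.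
  have e1 : x * a + y * b = 0.
    apply: (mulfI lam0); apply: (mulfI s0); rewrite !mulr0; apply: eq_opp_eq0.
    transitivity (s * (x ^+ q * a + z ^+ q * b)); first by rewrite ab1.
    by move: cd1; rewrite cE dE => e; transitivity (x ^+ q * (s * a) + z ^+ q * (s * b)); [ring|rewrite e; ring].
  have e2 : z * a + t * b = 0.
    apply: (mulfI lam0); apply: (mulfI s0); rewrite !mulr0; apply: eq_opp_eq0.
    transitivity (s * (y ^+ q * a + t ^+ q * b)); first by rewrite ab2.
    by move: cd2; rewrite cE dE => e; transitivity (y ^+ q * (s * a) + t ^+ q * (s * b)); [ring|rewrite e; ring].
  have a0 : a * quad r = 0.
    by transitivity (t * (x * a + y * b) - y * (z * a + t * b)); [rewrite /quad -/x -/y -/z -/t; ring|rewrite e1 e2 !mulr0 subrr].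
  have b0 : b * quad r = 0.
    by transitivity (x * (z * a + t * b) - z * (x * a + y * b)); [rewrite /quad -/x -/y -/z -/t; ring|rewrite e1 e2 !mulr0 subrr].
  move: ab0; move/eqP: a0; rewrite mulf_eq0 (negPf Qr) orbF => ->.
  by move/eqP: b0; rewrite mulf_eq0 (negPf Qr) orbF => ->.
(* Rescaling the second eigenvector makes the determinant 1. *)
pose c := c' / D; pose d := d' / D.
have cD : c * D = c' by rewrite divfK.
have dD : d * D = d' by rewrite divfK.
clearbody c d.
have e1 : x ^+ q * c + z ^+ q * d = - lam * (x * c + y * d).
  apply: (mulIf D0); transitivity (x ^+ q * (c * D) + z ^+ q * (d * D)); first by ring.
  by rewrite cD dD cd1 -cD -dD; ring.
have e2 : y ^+ q * c + t ^+ q * d = - lam * (z * c + t * d).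
  apply: (mulIf D0); transitivity (y ^+ q * (c * D) + t ^+ q * (d * D)); first by ring.
  by rewrite cD dD cd2 -cD -dD; ring.
have detA : a * d - b * c = 1.
  by apply: (mulIf D0); rewrite mul1r {2}/D -cD -dD; ring.
exists (mx2 a b c d); first by rewrite det_mx2E.
have [] := coord_kron (mx2 a b c d) r; have [-> -> -> ->] := mx2E a b c d.
rewrite -/x -/y -/z -/t => -> -> -> ->.
set y0 := a ^+ q * (a * x + b * y) + _; set y1 := a ^+ q * (c * x + d * y) + _.
set y2 := c ^+ q * (a * x + b * y) + _; set y3 := c ^+ q * (c * x + d * y) + _.
(* As the rows of [A] are eigenvectors, Frobenius sends entry (i, j) of the transformed matrix to
   the eigenvalue of row i times entry (j, i). *)
have y0q : y0 ^+ q = lam * y0.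
  transitivity (a ^+ q * (x ^+ q * a + z ^+ q * b) + b ^+ q * (y ^+ q * a + t ^+ q * b)).
    by rewrite /y0 !(frobD, exprMn, frobK); ring.
  by rewrite ab1 ab2 /y0; ring.
have y1q : y1 ^+ q = lam * y2.
  transitivity (c ^+ q * (x ^+ q * a + z ^+ q * b) + d ^+ q * (y ^+ q * a + t ^+ q * b)).
    by rewrite /y1 !(frobD, exprMn, frobK); ring.
  by rewrite ab1 ab2 /y2; ring.
have y2q : y2 ^+ q = - lam * y1.
  transitivity (a ^+ q * (x ^+ q * c + z ^+ q * d) + b ^+ q * (y ^+ q * c + t ^+ q * d)).
    by rewrite /y2 !(frobD, exprMn, frobK); ring.
  by rewrite e1 e2 /y1; ring.
have y3q : y3 ^+ q = - lam * y3.
  transitivity (c ^+ q * (x ^+ q * c + z ^+ q * d) + d ^+ q * (y ^+ q * c + t ^+ q * d)).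
    by rewrite /y3 !(frobD, exprMn, frobK); ring.
  by rewrite e1 e2 /y3; ring.
(* Applying Frobenius twice negates the off-diagonal entries when [lam] has norm 1, and [lam] does
   have norm 1 as soon as a diagonal entry is nonzero. *)
have off : lam ^+ q * lam = 1 -> y1 = 0 /\ y2 = 0.
  move=> nl; split; apply: eq_opp_eq0.
    by rewrite -[LHS]frobK y1q exprMn y2q mulNr mulrN mulrA nl mul1r.
  by rewrite -[LHS]frobK y2q exprMn y1q frobN mulNr mulrA nl mul1r.
case: (eqVneq y0 0) => [y00|y00].
  case: (eqVneq y3 0) => [y30|y30]; [by right|left; apply: off].
  apply: (mulIf y30); rewrite mul1r -[RHS]frobK y3q exprMn y3q frobN.
  by ring.
left; apply: off; apply: (mulIf y00).
by rewrite mul1r -[RHS]frobK y0q exprMn y0q mulrA.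
Qed.

(** The nonzero first row and one entry of the second determine the matrix; the entry to keep is
    [A 1 1] if [A 0 0 = 0], and [A 1 0] otherwise. *)
Lemma card_SL2 : (#|[set A : 'M[F]_2 | \det A == 1%R]| <= (q ^ 2 * q ^ 2 - 1) * q ^ 2)%N.
Proof.
pose f (A : 'M[F]_2) := ((A 0 0, A 0 1), if A 0 0 == 0 then A 1 1 else A 1 0).
have inj : {in [set A : 'M[F]_2 | \det A == 1%R] &, injective f}.
  move=> A B; rewrite !inE !det_mx2 => /eqP dA /eqP dB [e00 e01].
  have mxP : A 1 0 = B 1 0 -> A 1 1 = B 1 1 -> A = B.
    move=> e10 e11; apply/matrixP=> i j.
    have two (l : 'I_2) : l = 0 \/ l = 1 by case: l => [[|[|l]]] ltl //; [left|right]; exact: val_inj.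
    by case: (two i) => ->; case: (two j) => ->.
  rewrite e00 e01 in dA *; case: (eqVneq (B 0 0) 0) dA dB => [->|n0] dA dB e.
    apply: mxP => //; move: dA; rewrite -dB !mul0r !sub0r => /oppr_inj/mulfI; apply.
    by apply/negP=> /eqP z; move/eqP: dB; rewrite z !mul0r subrr eq_sym oner_eq0.
  apply: mxP => //; apply: (mulfI n0); move: dA; rewrite -dB e; exact: addIr.
rewrite -(card_in_imset inj).
have sub : f @: [set A : 'M[F]_2 | \det A == 1%R] \subset setX [set~ (0, 0)] [set: F].
  apply/subsetP=> _ /imsetP[A dA ->]; move: dA; rewrite inE det_mx2 => /eqP dA.
  rewrite !inE andbT; apply/negP=> /eqP[z0 z1]; move/eqP: dA.
  by rewrite z0 z1 !mul0r subrr eq_sym oner_eq0.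
apply: (leq_trans (subset_leq_card sub)).
by rewrite cardsX cardsT cardsC1 card_prod card_F subn1.
Qed.

(* A diagonal point is fixed by the [2 * (q + 1)] diagonal matrices of determinant 1
   with [a ^+ (2 * (q + 1)) = 1]. *)
Lemma card_K_orbit_diag (s t : F) : vec4 s 0 0 t != 0 ->
  (#|K_orbit q <[vec4 s 0 0 t]>%VS| * (4 * k.+1) <= (q ^ 2 * q ^ 2 - 1) * q ^ 2)%N.
Proof.
move=> st0; set P := <[vec4 s 0 0 t]>%VS.
pose a (i : 'I_(4 * k.+1)) := xi ^+ (k * i).
pose Dg i := mx2 (a i) 0 0 (a i)^-1.
have a0 i : a i != 0 by rewrite expf_neq0 ?xi_neq0.
have detD i : \det (Dg i) = 1 by rewrite det_mx2E mul0r subr0 mulfV.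
have fixD i : proj_map (kron q (Dg i)) P = P.
  (* The two outer coordinates are scaled by [a i ^+ q.+1] and its inverse, which agree because the
     square is 1. *)
  have aq : a i ^+ q * a i * (a i ^+ q * a i) = 1.
    apply/eqP; rewrite -exprSr -exprD -exprM xi_expr_eq1 q_def; apply/dvdnP; exists i.
    by lia.
  rewrite proj_map_vline; apply/esym/eqP/vline_eqP => //.
  have aq0 : a i ^+ q != 0 by rewrite expf_neq0.
  exists (a i ^+ q * a i); first by rewrite mulf_neq0.
  have [e0 e1 e2 e3] := coord_kron (Dg i) (vec4 s 0 0 t).
  have [d0 d1 d2 d3] := mx2E (a i) 0 0 (a i)^-1.
  rewrite /Dg d0 d1 d2 d3 in e0 e1 e2 e3.
  apply: coord_inj; rewrite coordZ (e0, e1, e2, e3) !coord_vec4 frob0.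
  - by ring.
  - by ring.
  - by ring.
  have -> : a i ^+ q * a i = (a i ^+ q * a i)^-1 by apply: (mulfI (mulf_neq0 aq0 (a0 i))); rewrite aq mulfV ?mulf_neq0.
  by rewrite exprVn; field; rewrite a0.
have reprP Q : Q \in K_orbit q P -> exists A : 'M[F]_2, (\det A == 1) && (Q == proj_map (kron q A) P).
  by case/imsetP=> A; rewrite inE => dA ->; exists A; rewrite dA eqxx.
pose rep Q := odflt 1%:M [pick A : 'M[F]_2 | (\det A == 1) && (Q == proj_map (kron q A) P)].
have repP Q : Q \in K_orbit q P -> \det (rep Q) = 1 /\ Q = proj_map (kron q (rep Q)) P.
  move=> /reprP[A AP]; rewrite /rep; case: pickP => [B /andP[/eqP dB /eqP QB] //|/(_ A)].
  by rewrite AP.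
(* Coset representatives times stabilizer elements: the product determines the point, as the image
   of [P], and then the diagonal factor. *)
pose f (x : space * 'I_(4 * k.+1)) := rep x.1 *m Dg x.2.
rewrite -[X in (_ * X <= _)%N]card_ord -cardsT -cardsX.
have fP (x : space * 'I_(4 * k.+1)) : x \in setX (K_orbit q P) [set: 'I_(4 * k.+1)] -> x.1 = proj_map (kron q (f x)) P.
  rewrite !inE andbT => /repP[_ xE]; rewrite {1}xE -{1}(fixD x.2) /proj_map -limg_comp; congr (_ @: _)%VS.
  by apply/lfunP=> u; rewrite comp_lfunE !lfunE /= kron_mulv.
have inj : {in setX (K_orbit q P) [set: 'I_(4 * k.+1)] &, injective f}.
  move=> [Q i] [R j] xX yX e; have /= QE := fP _ xX; have /= RE := fP _ yX.
  have QR : Q = R by rewrite QE RE e.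
  congr pair => //; move: e xX; rewrite /f !inE andbT /= -QR => e /repP[dr _].
  have ur : rep Q \in unitmx by rewrite unitmxE dr unitr1.
  have := congr1 (mulmx (invmx (rep Q))) e; rewrite !mulKmx // => /matrixP/(_ 0 0).
  rewrite !mxE /= => /eqP; rewrite (eq_prim_root_expr xi_prim) order_half => /eqP e'.
  apply: val_inj; apply/eqP; rewrite -(eqn_pmul2l k_gt0); apply/eqP.
  have li := ltn_ord i; have lj := ltn_ord j.
  by move: e'; rewrite !modn_small; [|nia..].
rewrite -(card_in_imset inj); apply: leq_trans card_SL2.
apply/subset_leq_card/subsetP=> _ /imsetP[x xX ->]; rewrite inE det_mulmx detD mulr1.
by move: xX; rewrite !inE andbT => /repP[-> _].
Qed.

Lemma proj_map_kron (A B : 'M[F]_2) P : proj_map (kron q A) (proj_map (kron q B) P) = proj_map (kron q (A *m B)) P.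
Proof.
rewrite /proj_map -limg_comp; congr (_ @: _)%VS.
by apply/lfunP=> u; rewrite comp_lfunE !lfunE /= kron_mulv.
Qed.

Lemma K_orbit_eq P (A : 'M[F]_2) : \det A = 1 ->
  K_orbit q (proj_map (kron q A) P) = K_orbit q P.
Proof.
move=> dA; have uA : A \in unitmx by rewrite unitmxE dA unitr1.
apply/setP=> Q; apply/imsetP/imsetP => -[B]; rewrite inE => /eqP dB ->.
  by exists (B *m A); rewrite ?inE ?det_mulmx ?dA ?dB ?mulr1 ?proj_map_kron.
exists (B *m invmx A); first by rewrite inE det_mulmx det_inv dA dB invr1 mulr1.
by rewrite proj_map_kron mulmxKV.
Qed.

(** The map is additive, and an element [c] of its kernel satisfies [c = c * m ^+ q.+1 = - c]; being
    injective on a finite set, it is onto. *)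
Lemma frob_shift_onto (m : F) : m ^+ q.+1 = -1 -> forall t, exists b, b + b ^+ q * m = t.
Proof.
move=> mN; have inj : injective (fun b : F => b + b ^+ q * m).
  move=> b b' /= e; apply/eqP; rewrite -subr_eq0; set c := b - b'.
  have cE : c = - (c ^+ q * m).
    apply/eqP; rewrite -addr_eq0 /c frobB; apply/eqP.
    by transitivity ((b + b ^+ q * m) - (b' + b' ^+ q * m)); [ring|rewrite e subrr].
  have cq : c ^+ q = - (c * m ^+ q) by rewrite {1}cE frobN exprMn frobK.
  by apply/eqP/eq_opp_eq0; rewrite {1}cE cq mulNr opprK -mulrA -exprSr mN mulrN1.
have [g _ gK] := injF_bij inj.
by move=> t; exists (g t); exact: gK.
Qed.

Lemma is_H2_lines X : is_H2 q X -> exists r m, [/\ r != 0, herm r r = 0, quad r != 0,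
  X = K_orbit q <[r]>%VS & [/\ m != 0, m ^+ q.+1 != 1 &
   forall m' t, m' \in [:: m; m * xi ^+ (2 * (2 * k)); m^-1] -> <[vec4 t 1 m' 0]>%VS \in X]].
Proof.
case=> /imsetP[P /HS_off_OO[r [r0 -> hr Qr]] XE] cardX.
have [A dA nf] := K_normal_form hr Qr.
set s := kron q A *m r in nf; have s0 : s != 0 by rewrite kron_neq0.
have XEs : X = K_orbit q <[s]>%VS by rewrite XE -proj_map_vline K_orbit_eq.
have hs : herm s s = 0 by rewrite herm_kron.
have Qs : quad s != 0 by rewrite quad_kron.
clearbody s; case: nf => [[s1 s2]|[s03 s3]].
  (* Such an orbit has at most [q ^ 2 * (q ^ 2 + 1) * (q - 1) / 2] points, fewer than [X] has. *)
  have sE : s = vec4 (coord s 0) 0 0 (coord s 3) by rewrite [LHS]vec4_eta s1 s2.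
  have := card_K_orbit_diag (s := coord s 0) (t := coord s 3); rewrite -sE -XEs cardX => /(_ s0).
  have -> : (q ^ 2 * (q ^ 2 + 1) * (q + 1) %/ 2 = q ^ 2 * (q ^ 2 + 1) * k.+1)%N.
    by rewrite (_ : (q + 1 = k.+1 * 2)%N) ?mulnA ?mulnK // q_def; lia.
  have q2 : (q ^ 2 = 4 * (k * k.+1) + 1)%N by rewrite q_def; nia.
  rewrite leqNgt (_ : (_ < _)%N) //.
  have -> : (q ^ 2 * q ^ 2 - 1 = (q ^ 2 + 1) * (q ^ 2 - 1))%N by rewrite q2; nia.
  have q20 : (0 < q ^ 2 * (q ^ 2 + 1))%N by rewrite muln_gt0 addn1 q2 addn1.
  rewrite [X in (X < _)%N]mulnC mulnA -[X in (_ < X)%N]mulnA ltn_pmul2l //.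
  by rewrite q2 addnK; nia.
have y0 : coord s 1 != 0.
  by move: Qs; rewrite /quad s03 mul0r sub0r oppr_eq0 mulf_eq0 negb_or => /andP[].
pose m := coord s 2 / coord s 1.
have mN : m ^+ q.+1 = -1.
  apply: (mulIf (expf_neq0 q.+1 y0)); rewrite /m expr_div_n divfK ?expf_neq0 //.
  apply/eqP; rewrite mulN1r -addr_eq0 addrC -oppr_eq0 -[X in _ == X]hs /herm s03 s3 frob0; apply/eqP.
  by rewrite !exprS; ring.
have m0 : m != 0.
  by apply/eqP=> e; move/eqP: mN; rewrite e expr0n /= eq_sym oppr_eq0 oner_eq0.
have mX : <[vec4 0 1 m 0]>%VS \in X.
  suff -> : <[vec4 0 1 m 0]>%VS = <[s]>%VS :> space by rewrite XEs K_orbit_refl.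
  apply/eqP/vline_eqP; first exact: vec4_line_neq0.
  exists (coord s 1) => //; apply: coord_inj; rewrite coordZ !coord_vec4 ?s03 ?s3 ?mulr0 ?mulr1 //.
  by rewrite mulrC divfK.
have stepX v w (c : F) (B : 'M[F]_2) : w != 0 -> c != 0 -> \det B = 1 -> kron q B *m v = c *: w ->
    <[v]>%VS \in X -> <[w]>%VS \in X.
  move=> w0 c0 dB e; rewrite XE => /(K_orbit_kron dB); rewrite e.
  suff -> : <[c *: w]>%VS = <[w]>%VS by [].
  by apply/esym/eqP/vline_eqP => //; exists c.
(* The unipotent matrix with upper right entry [b] sends [(0, 1, m', 0)] to
   [(b + b ^+ q * m', 1, m', 0)]. *)
have shift m' t : m' ^+ q.+1 = -1 -> <[vec4 0 1 m' 0]>%VS \in X -> <[vec4 t 1 m' 0]>%VS \in X.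
  move=> m'N; have [b bE] := frob_shift_onto m'N t.
  apply: (stepX _ _ 1 (mx2 1 b 0 1)); rewrite ?oner_eq0 ?vec4_line_neq0 ?det_mx2E ?mulr1 ?mulr0 ?subr0 //.
  rewrite scale1r; have [] := coord_kron (mx2 1 b 0 1) (vec4 0 1 m' 0).
  have [-> -> -> ->] := mx2E 1 b 0 1; rewrite !coord_vec4 => e0 e1 e2 e3.
  apply: coord_inj; rewrite (e0, e1, e2, e3) coord_vec4 !expr1n ?frob0 -?bE; ring.
have zN : (m * xi ^+ (2 * (2 * k))) ^+ q.+1 = -1.
  rewrite exprMn mN -exprM; suff /eqP -> : xi ^+ (2 * (2 * k) * q.+1) == 1 by rewrite mulr1.
  by rewrite xi_expr_eq1 q_def; apply/dvdnP; exists 2; lia.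
have vN : m^-1 ^+ q.+1 = -1 by rewrite exprVn mN invrN invr1.
exists r, m; split=> //; split=> // [|m' t].
  by rewrite mN; apply: contraNneq two_neq0 => /esym e; rewrite mulr2n {1}e addNr.
rewrite !inE => /or3P[] /eqP->.
- exact: shift.
(* The diagonal matrix with entries [xi^-1] and [xi] multiplies the ratio [m] by
   [xi ^+ (2 * (q - 1))]. *)
- apply: (shift _ _ zN); have [a a0 aE] : exists2 a : F, a != 0 & a = xi^-1.
    by exists xi^-1; rewrite ?invr_eq0 ?xi_neq0.
  have aq0 : a ^+ q != 0 by rewrite expf_neq0.
  apply: (stepX _ _ (a ^+ q / a) (mx2 a 0 0 a^-1) _ _ _ _ mX).
  + exact: vec4_line_neq0.
  + by rewrite mulf_neq0 ?invr_neq0.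
  + by rewrite det_mx2E mul0r subr0 mulfV.
  have [] := coord_kron (mx2 a 0 0 a^-1) (vec4 0 1 m 0).
  have [-> -> -> ->] := mx2E a 0 0 a^-1; rewrite !coord_vec4 => e0 e1 e2 e3.
  apply: coord_inj; rewrite (e0, e1, e2, e3) coordZ coord_vec4 ?frob0; try ring.
  have -> : xi ^+ (2 * (2 * k)) = (a / a ^+ q) ^+ 2.
    have aqE : a ^+ q = (xi ^+ (2 * k) * xi)^-1.
      by rewrite aE exprVn xi_exprq.
    by rewrite aqE invrK aE (mulrC _ xi) mulKf ?xi_neq0 // -exprM mulnC.
  by rewrite exprVn; field; rewrite a0 aq0.
apply: (shift _ _ vN).
(* This matrix sends [(0, 1, m, 0)] to [(0, - m, -1, 0)]. *)
apply: (stepX _ _ (- m) (mx2 0 1 (-1) 0) _ _ _ _ mX).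
- exact: vec4_line_neq0.
- by rewrite oppr_eq0.
- by rewrite det_mx2E mul0r sub0r mulrN1 opprK.
have [] := coord_kron (mx2 0 1 (-1) 0) (vec4 0 1 m 0).
have [-> -> -> ->] := mx2E 0 1 (-1) 0; rewrite !coord_vec4 frob0 frobN !expr1n => e0 e1 e2 e3.
apply: coord_inj; rewrite (e0, e1, e2, e3) coordZ coord_vec4; try ring.
by field.
Qed.

(** When [herm v v = 0], the equation of [E_set] forces [quad v ^+ k.+1 = 0], so such points satisfy
    the condition imposed by a K-orbit on the Hermitian surface. *)
Lemma E_set_norm_type_HS i v : k_range q i -> <[v]>%VS \in E_set q xi i -> herm v v = 0 ->
  forall eps, norm_type eps v.
Proof.
move=> ri; rewrite E_setE mem_zeros_F_eq F_eqE => /andP[_ /eqP e] hv eps.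
move/eqP: e; rewrite hv sub0r oppr_eq0 mulf_eq0 (negPf (gE_neq0 ri)) /= => /eqP N0.
by rewrite /norm_type N0 frob0 mulr0.
Qed.

Lemma S_set_norm_type_HS j v : j_range q j -> <[v]>%VS \in S_set q xi j -> herm v v = 0 ->
  forall eps, norm_type eps v.
Proof.
move=> rj; rewrite S_setE mem_zeros_F_eq F_eqE => /andP[_ /eqP e] hv eps.
move/eqP: e; rewrite hv sub0r oppr_eq0 mulf_eq0 (negPf (gS_neq0 rj)) /= => /eqP N0.
by rewrite /norm_type N0 frob0 mulr0.
Qed.

Lemma zero_sqr_neq4 : (0 : F) ^+ 2 != 4%:R.
Proof. by rewrite expr0n /= eq_sym (natrM _ 2 2) mulf_neq0 ?two_neq0. Qed.

(** The three lines come from [E_set] in the first two cases and from H_2 in the third. For a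
    K-orbit the surface parameter is 0, and [K_orbit_type] supplies the norm type. *)
Lemma type_V4_model V : type_V4 q xi V -> exists g1 g2 eps1 eps2 m, surface_model g1 g2 eps1 eps2 m V.
Proof.
case=> [[j [i [rj ri ->]]]|[H1 [i [[/imsetP[P Pin H1E] _] ri ->]]]|[j [H2 [rj H2V ->]]]].
- have [m0 mN ml] := E_set_lines ri; set m := - _ in m0 mN ml.
  exists (gS j), (gE i), (gS j / gS j ^+ q), (gE i / gE i ^+ q), m; split=> //.
  + by rewrite subUset S_setE E_setE !zeros_sub.
  + move=> v _; rewrite in_setU S_setE E_setE !mem_zeros_F_eq.
    by case/orP=> /andP[_ /eqP]; [left|right].
  + by move=> v _ _; apply: norm_type_F_eq; exact: gS_neq0.
  + by move=> v _ _; apply: norm_type_F_eq; exact: gE_neq0.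
  + exact/norm_type_ratio_neq0/gS_neq0.
  + exact/norm_type_ratio_neq0/gE_neq0.
  + exact: gS_sqr.
  + exact: gE_sqr.
  + move=> A v dA; rewrite !in_setU S_setE E_setE => /orP[] /(zeros_kron dA) ->; by rewrite ?orbT.
  + by rewrite in_setU S_setE zeros_base.
  + by move=> m' t /(ml m' t) h; rewrite in_setU h orbT.
- have [m0 mN ml] := E_set_lines ri; set m := - _ in m0 mN ml.
  have [r [r0 PE hr Qr]] := HS_off_OO Pin; rewrite {P Pin}PE in H1E.
  have [eps eps0 type1] := K_orbit_type r0 hr Qr.
  exists 0, (gE i), eps, (gE i / gE i ^+ q), m; split=> //.
  + by rewrite subUset E_setE zeros_sub H1E K_orbit_sub ?vline_point.
  + move=> v v0; rewrite in_setU H1E E_setE mem_zeros_F_eq.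
    by case/orP=> [/(type1 v v0)[]|/andP[_ /eqP]]; [left|right].
  + move=> v v0; rewrite in_setU H1E => /orP[/(type1 v v0)[]//|vE].
    by rewrite F_eqE mul0r subr0 => hv; exact: E_set_norm_type_HS vE hv _.
  + by move=> v _ _; apply: norm_type_F_eq; exact: gE_neq0.
  + exact/norm_type_ratio_neq0/gE_neq0.
  + exact: zero_sqr_neq4.
  + exact: gE_sqr.
  + move=> A v dA; rewrite !in_setU H1E E_setE => /orP[/(K_orbit_kron dA) ->//|/(zeros_kron dA) ->].
    by rewrite orbT.
  + by rewrite in_setU E_setE zeros_base orbT.
  + by move=> m' t /(ml m' t) h; rewrite in_setU h orbT.
have [r [m [r0 hr Qr H2E [m0 mN ml]]]] := is_H2_lines H2V.
have [eps eps0 type2] := K_orbit_type r0 hr Qr.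
exists (gS j), 0, (gS j / gS j ^+ q), eps, m; split=> //.
+ by rewrite subUset S_setE zeros_sub H2E K_orbit_sub ?vline_point.
+ move=> v v0; rewrite in_setU H2E S_setE mem_zeros_F_eq.
  by case/orP=> [/andP[_ /eqP]|/(type2 v v0)[]]; [left|right].
+ by move=> v _ _; apply: norm_type_F_eq; exact: gS_neq0.
+ move=> v v0; rewrite in_setU H2E => /orP[vS|/(type2 v v0)[]//].
  by rewrite F_eqE mul0r subr0 => hv; exact: S_set_norm_type_HS vS hv _.
+ exact/norm_type_ratio_neq0/gS_neq0.
+ exact: gS_sqr.
+ exact: zero_sqr_neq4.
+ move=> A v dA; rewrite !in_setU H2E S_setE => /orP[/(zeros_kron dA) ->//|/(K_orbit_kron dA) ->].
  by rewrite orbT.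
+ by rewrite in_setU S_setE zeros_base.
+ by move=> m' t /(ml m' t) h; rewrite in_setU h orbT.
Qed.

End HermitianGeometry.

Unset Implicit Arguments.

Theorem corollary3p5 (p e q : nat) (F : finFieldType) (xi : F)
    (p_prime : prime p) (e_gt0 : 0 < e) (q_def : q = p ^ e) (q_odd : odd q)
    (card_F : #|F| = q ^ 2)
    (xi_prim : ((q ^ 2 - 1)%N.-primitive_root xi)%R)
    (V4 V : {set {vspace 'cV[F]_4}})
    (V4_type : type_V4 q xi V4)
    (V_type : type_V1 q V \/ type_V2 q V \/ type_V3 q V) :
  ~ proj_equiv V4 V.
Proof.
have pcharF : p \in [pchar F]%R by apply: (@card_finPcharP F p (e * 2)); rewrite // card_F q_def expnM.
have frobD (x y : F) : ((x + y) ^+ q = x ^+ q + y ^+ q)%R.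
  by apply: exprDn_pchar; rewrite (eq_pnat _ (pcharf_eq pcharF)) q_def pnatX pnat_id.
have q_eq0 : (q%:R = 0 :> F)%R by rewrite q_def natrX (pcharf0 pcharF) expr0n eqn0Ngt e_gt0.
have q_half : q = 2 * q./2 + 1 by rewrite mul2n addn1 -add1n -[LHS]odd_double_half q_odd.
have half_q_gt0 : 0 < q./2 by rewrite half_gt0 q_def -(expn0 p) ltn_exp2l ?prime_gt1.
case=> M uM VE.
have [g1 [g2 [eps1 [eps2 [m model]]]]] :=
  type_V4_model q_half half_q_gt0 card_F frobD q_eq0 xi_prim V4_type.
have conf4 := model_configuration q_half half_q_gt0 card_F frobD q_eq0 xi_prim model.
have conf := configuration_proj_map uM conf4; rewrite -VE in conf.
case: V_type => [|[]].
- exact: (configuration_not_type_V1 q_half half_q_gt0 card_F frobD xi_prim conf).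
- exact: (configuration_not_type_V2 q_half half_q_gt0 card_F frobD conf).
- exact: (configuration_not_type_V3 q_half half_q_gt0 conf).
Qed.
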